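(* Suppose $n$ is an odd integer with $n\geq t_1+t_2+t_3$, and put $K=k_1+k_2+k_3$, $N=\tfrac{n+1}{2}$, $\mathscr M=\mathscr M_n(x_1)\cap\mathscr M_n(x_2)\cap\mathscr M_n(x_3)$. Let $W_0=O_{n-t_1-t_2-t_3}(k_1+N,\,k_2+N,\,k_3+N)$, $A=O_{t_1-1}(-K-n-1,\,k_3,\,k_2)$, $B=O_{t_2-1}(k_3,\,-K-n-1,\,k_1)$, $C=O_{t_3-1}(k_2,\,k_1,\,-K-n-1)$. Then, as $\mathfrak{BI}$-modules: (i) $\mathscr M\cong W_0\oplus W_0$; (ii) $\mathscr M_n/\mathscr M_n(x_1)\cong A\oplus A$; (iii) $\mathscr M_n/\mathscr M_n(x_2)\cong B\oplus B$; (iv) $\mathscr M_n/\mathscr M_n(x_3)\cong C\oplus C$; (v) $\mathscr M_n(x_1)/\mathscr M\cong B\oplus B\oplus C\oplus C$; (vi) $\mathscr M_n(x_2)/\mathscr M\cong A\oplus A\oplus C\oplus C$; (vii) $\mathscr M_n(x_3)/\mathscr M\cong A\oplus A\oplus B\oplus B$. Moreover, $W_0,A,B,C$ are irreducible.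
   Context: Fix real numbers $k_1,k_2,k_3$. For $i=1,2,3$ let $R_i$ be the operator on functions on $\mathbb R^3$ replacing $x_i$ by $-x_i$, and $T_if=\frac{\partial f}{\partial x_i}+k_i\frac{f-R_if}{x_i}$ (Dunkl operators). Let $\sigma_1=\begin{pmatrix}0&1\\1&0\end{pmatrix}$, $\sigma_2=\begin{pmatrix}0&-\sqrt{-1}\\ \sqrt{-1}&0\end{pmatrix}$, $\sigma_3=\begin{pmatrix}1&0\\0&-1\end{pmatrix}$, and let $e_i$ act on $\mathbb C^2$ by $\sigma_i$. Tensor products are over $\mathbb R$; $\mathbb R[\cdots]_m$ denotes homogeneous polynomials of degree $m$. Let $\mathbf D=e_1\otimes T_1+e_2\otimes T_2+e_3\otimes T_3$ and $\mathscr M_n=\ker(\mathbf D|_{\mathbb C^2\otimes\mathbb R[x_1,x_2,x_3]_n})$. For $i=1,2,3$ set $t_i=-2k_i$ if $2k_i$ is an odd negative integer, and $t_i=\infty$ otherwise. For $i=1,2,3$, $\mathscr M_n(x_i)=\mathscr M_n\cap\bigoplus_{j=t_i}^n\mathbb C^2\otimes(x_i^j\cdot\mathbb R[x_p,x_q]_{n-j})$ where $\{p,q\}=\{1,2,3\}\setminus\{i\}$ (it is $\{0\}$ if $n<t_i$); it is a $\mathfrak{BI}$-submodule of $\mathscr M_n$. $\mathfrak{BI}$ is the unital associative $\mathbb C$-algebra generated by $X,Y,Z$ with relations saying that $\{X,Y\}-Z$, $\{Y,Z\}-X$, $\{Z,X\}-Y$ commute with $X,Y,Z$ ($\{A,B\}=AB+BA$).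 $\mathscr M_n$ is a $\mathfrak{BI}$-module via $X=(\sqrt{-1}\,e_1\otimes(x_3T_2-x_2T_3)+\tfrac12)R_2R_3+k_2R_3+k_3R_2$, $Y=(\sqrt{-1}\,e_2\otimes(x_1T_3-x_3T_1)+\tfrac12)R_1R_3+k_3R_1+k_1R_3$, $Z=(\sqrt{-1}\,e_3\otimes(x_2T_1-x_1T_2)+\tfrac12)R_1R_2+k_1R_2+k_2R_1$, operators composed right to left, $R_i$ acting on the polynomial factor. For $a,b,c\in\mathbb C$ and even $d\geq0$, $O_d(a,b,c)$ is the $\mathfrak{BI}$-module $\mathbb C^{d+1}$ in which, w.r.t. a basis $v_0,\dots,v_d$, $X$ acts by the lower bidiagonal matrix with diagonal $(\theta_0,\dots,\theta_d)$ and subdiagonal entries $1$, $Y$ by the upper bidiagonal matrix with diagonal $(\theta^*_0,\dots,\theta^*_d)$ and superdiagonal $(\varphi_1,\dots,\varphi_d)$, and $Z=\{X,Y\}-(2ab-c(d+1))$, where $\theta_i=\frac{(-1)^i(2a-d+2i)}{2}$, $\theta^*_i=\frac{(-1)^i(2b-d+2i)}{2}$, $\varphi_i=\frac{i(d+1-2i-2a-2b-2c)}{2}$ ($i$ even), $\varphi_i=\frac{(i-d-1)(d+1-2i-2a-2b+2c)}{2}$ ($i$ odd). *)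

(* Defs.v *)
From HB Require Import structures.
From mathcomp Require Import all_boot all_order all_algebra.
From mathcomp Require Import reals.
From mathcomp Require Import complex.
From mathcomp Require Import mpoly.

Set Implicit Arguments.
Unset Strict Implicit.
Unset Printing Implicit Defensive.

Import Order.TTheory GRing.Theory Num.Theory.
Local Open Scope ring_scope.

Section BannaiIto.

Variable R : realType.
Local Notation C := (R[i]).
Local Notation P := {mpoly C[3]}.
(* C^2 (x)_R R[x1,x2,x3] identified with the complex space of pairs of
   complex polynomials: the pair (f1, f2) stands for e1 (x) f1 + e2 (x) f2
   where e1, e2 is the standard basis of C^2. *)
Definition V := (P * P)%type.

Definition rc (x : R) : C := Complex x 0.

Definition refl (i : 'I_3) (f : P) : P :=
  f \mPo [tuple (if j == i then - 'X_j else 'X_j) | j < 3].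

(* division by the monomial x_i (exact on polynomials divisible by x_i) *)
Definition divX (i : 'I_3) (f : P) : P :=
  \sum_(m <- msupp f | (0 < m i)%N) f@_m *: 'X_[(m - U_(i))%MM].

Definition dunkl (k : 'I_3 -> R) (i : 'I_3) (f : P) : P :=
  mderiv i f + rc (k i) *: divX i (f - refl i f).

Definition pauli (a : 'I_3) (v : V) : V :=
  match val a with
  | 0 => (v.2, v.1)
  | 1 => (- 'i *: v.2, 'i *: v.1)
  | _ => (v.1, - v.2)
  end.

Definition polyop (L : P -> P) (v : V) : V := (L v.1, L v.2).

Definition cliff (a : 'I_3) (L : P -> P) (v : V) : V := pauli a (polyop L v).

Definition dirac (k : 'I_3 -> R) (v : V) : V :=
  \sum_(i < 3) cliff i (dunkl k i) v.

Definition homogV (n : nat) (v : V) : Prop :=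
  v.1 \is n.-homog /\ v.2 \is n.-homog.

Definition Mn (k : 'I_3 -> R) (n : nat) (v : V) : Prop :=
  homogV n v /\ dirac k v = 0.

(* t_i = -2 k_i if 2 k_i is an odd negative integer, infinity (None) otherwise *)
Definition tpar (k : R) : option nat :=
  let x := - (2 * k) in
  if (x \is a Num.Def.nat_num) && odd (Num.truncn x) then Some (Num.truncn x)
  else None.

(* M_n(x_i) = M_n intersected with (+)_{j = t_i}^n C^2 (x) x_i^j R[x_p,x_q]_{n-j} *)
Definition Mnx (k : 'I_3 -> R) (n : nat) (i : 'I_3) (v : V) : Prop :=
  Mn k n v /\
  match tpar (k i) with
  | Some t => forall m, (m \in msupp v.1) || (m \in msupp v.2) -> (t <= m i)%N
  | None => v = 0
  end.

Definition angop (k : 'I_3 -> R) (p q : 'I_3) (f : P) : P :=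
  'X_q * dunkl k p f - 'X_p * dunkl k q f.

Definition biop (k : 'I_3 -> R) (a p q : 'I_3) (v : V) : V :=
  let w := polyop (refl p) (polyop (refl q) v) in
  'i *: cliff a (angop k p q) w + 2^-1 *: w
  + rc (k p) *: polyop (refl q) v + rc (k q) *: polyop (refl p) v.

Definition opX k := biop k 0 1 2.
Definition opY k := biop k 1 2 0.
Definition opZ k := biop k 2 0 1.

End BannaiIto.

(* A finite-dimensional BI-module given by the matrices of X, Y, Z acting on
   column coordinate vectors. *)
Record bimod (C : fieldType) := BIMod {
  bdim : nat;
  bX : 'M[C]_bdim;
  bY : 'M[C]_bdim;
  bZ : 'M[C]_bdim }.

Definition bisum (C : fieldType) (M1 M2 : bimod C) : bimod C :=
  @BIMod C (bdim M1 + bdim M2)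
    (block_mx (bX M1) 0 0 (bX M2))
    (block_mx (bY M1) 0 0 (bY M2))
    (block_mx (bZ M1) 0 0 (bZ M2)).

Definition bi_irreducible (C : fieldType) (M : bimod C) : Prop :=
  (0 < bdim M)%N /\
  forall S : 'cV[C]_(bdim M) -> Prop,
    S 0 ->
    (forall (a : C) u w, S u -> S w -> S (a *: u + w)) ->
    (forall u, S u -> S (bX M *m u) /\ S (bY M *m u) /\ S (bZ M *m u)) ->
    (forall u, S u -> u = 0) \/ (forall u, S u).

Section Omod.
Variable C : fieldType.
Variables (d : nat) (a b c : C).

Definition Otheta (i : nat) : C := (-1) ^+ i * (2 * a - d%:R + 2 * i%:R) / 2.
Definition Othetas (i : nat) : C := (-1) ^+ i * (2 * b - d%:R + 2 * i%:R) / 2.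
Definition Ophi (i : nat) : C :=
  if ~~ odd i then i%:R * (d%:R + 1 - 2 * i%:R - 2 * a - 2 * b - 2 * c) / 2
  else (i%:R - d%:R - 1) * (d%:R + 1 - 2 * i%:R - 2 * a - 2 * b + 2 * c) / 2.

Definition OX : 'M[C]_(d.+1) :=
  \matrix_(r, s) (if r == s then Otheta r
                  else if val r == (val s).+1 then 1 else 0).
Definition OY : 'M[C]_(d.+1) :=
  \matrix_(r, s) (if r == s then Othetas r
                  else if val s == (val r).+1 then Ophi s else 0).
Definition OZ : 'M[C]_(d.+1) :=
  OX *m OY + OY *m OX - (2 * a * b - c * (d.+1)%:R)%:M.

Definition Omod : bimod C := @BIMod C d.+1 OX OY OZ.
End Omod.

(* W/U is isomorphic, as a BI-module, to M:  W is stable under X, Y, Z and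
   there is a C-linear map f from the ambient space, restricting to a
   surjection W ->> C^(dim M) with kernel (in W) exactly U, intertwining
   X, Y, Z with the matrices of M (first isomorphism theorem). *)
Definition bi_subquot_iso (C : fieldType) (T : lmodType C)
  (X Y Z : T -> T) (W U : T -> Prop) (M : bimod C) : Prop :=
  exists f : {linear T -> 'cV[C]_(bdim M)},
    (forall w, W w -> W (X w) /\ W (Y w) /\ W (Z w)) /\
    (forall u, exists2 w, W w & f w = u) /\
    (forall w, W w -> (f w = 0 <-> U w)) /\
    (forall w, W w -> f (X w) = bX M *m f w /\ f (Y w) = bY M *m f w
                      /\ f (Z w) = bZ M *m f w).

(* Main.v *)
Require Import Defs.
From HB Require Import structures.
From mathcomp Require Import all_boot all_order all_algebra.
From mathcomp Require Import reals complex mpoly.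
From mathcomp Require Import boolp.
From mathcomp Require Import ring lra zify.
Import Order.TTheory GRing.Theory Num.Theory.
Local Open Scope ring_scope.
Set Implicit Arguments.
Unset Strict Implicit.
Unset Printing Implicit Defensive.

(** Diagonalise [sigma_p] on the spinors.  On a line of monomials with fixed exponent [t_p] of
    [x_p], the coefficients of a monogenic polynomial for each of the two eigenvectors of
    [sigma_p] span a space of functionals on which two of the operators [X, Y, Z] act by
    bidiagonal matrices; the eigenvectors account for the multiplicity two.  The
    restriction to a suitable line is surjective because a monogenic polynomial can be
    prescribed on the line and extended by the Cauchy-Kovalevskaya recursion in [x_p], and its
    kernel is found by running the same recursion on the regions where [T_i x_i^(t_i) = 0]
    decouples the coefficients.  A bidiagonal module is identified with [O_d] through the
    functionals obtained from one coordinate by the successive factors [X - xi_j]: the relation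
    expressing [Y] through [Z] and [X] propagates the action of [Y] along this chain. *)

(** * Bidiagonal pairs *)

(** The hypothesis [t1 + t2 + t3 <= n] prevents a monogenic of degree [n] from containing a monomial
    with two exponents below their thresholds. Its monomials fall into a core, where every exponent
    reaches its [t_i], and three arms, where exactly one falls short. The core carries the two
    copies of [W0], the arms carry [A], [B], [C], and preimages supported on the core and a single
    arm split the quotients (v)-(vii). The exponent [t_p] is singled out because [T_p] kills
    [x_p^(t_p)]: the coefficients there are free initial data. On a line the two operators are
    bidiagonal, but one of the two diagonals runs against the order required by [O_d]. The chain of
    functionals repairs this, and its nondegeneracy also gives irreducibility. The arm in [x_p] is
    invisible on the line of exponent [t_p], so the quotient by [Mnx k n 2] needs a line for another
    axis, where the bidiagonal pair is [(Y, Z)]. As [O_d] treats its three generators differently,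
    separate comparisons are made for [(LX, LY, LZ)], [(- LY, - LX, LZ)] and [(LZ, LX, LY)]. *)

Section Sequences.
Variables (F : numFieldType) (d : nat).
Implicit Types a b c : F.

(** [beta] and [psi] are the eigenvalues and the split parameters of [O_d(a, b, c)] read from
    the end of the basis; [zeta] is what makes [LX] and [LY] below satisfy the relations. *)
Definition beta b (j : nat) : F := (-1) ^+ j * (2 * b + d%:R - 2 * j%:R) / 2.

Definition psi a b c (j : nat) : F :=
  if odd j then (d%:R + 1 - j%:R) * (2 * j%:R - d%:R - 1 - 2 * (a + b + c)) / 2
  else - (j%:R * (2 * j%:R - d%:R - 1 - 2 * (a + b - c)) / 2).

Definition zeta a b c (j : nat) : F := - psi (- a) b (- c) j.

Lemma sign_parity (j : nat) : (-1) ^+ j = (if odd j then -1 else 1) :> F.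
Proof. by rewrite -signr_odd; case: (odd j); rewrite ?expr1 ?expr0. Qed.

End Sequences.

Section Bidiagonal.
Variables (F : fieldType) (d : nat).
Implicit Types (u v : 'cV[F]_d.+1) (al be x y : nat -> F).

(** Coordinates are indexed by all naturals, with value 0 beyond [d], so that recurrences involving
    [j.+1] need no side condition. *)
Definition co u (j : nat) : F := if insub j is Some i then u i 0 else 0.

Lemma coE u (i : 'I_d.+1) : co u i = u i 0.
Proof. by rewrite /co valK. Qed.

Lemma co_out u j : (d < j)%N -> co u j = 0.
Proof. by move=> ltdj; rewrite /co insubF // ltnNge ltdj. Qed.

Lemma coD u v j : co (u + v) j = co u j + co v j.
Proof. by rewrite /co; case: insub => [i|]; rewrite ?mxE ?addr0. Qed.

Lemma coZ k u j : co (k *: u) j = k * co u j.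
Proof. by rewrite /co; case: insub => [i|]; rewrite ?mxE ?mulr0. Qed.

Lemma co0 j : co 0 j = 0.
Proof. by rewrite /co; case: insub => // i; rewrite mxE. Qed.

Lemma coP u v : (forall j, (j <= d)%N -> co u j = co v j) <-> u = v.
Proof.
split=> [eq_co|-> //]; apply/matrixP=> i k; rewrite ord1 -!coE.
by apply: eq_co; rewrite -ltnS.
Qed.

Definition upmx al x : 'M[F]_d.+1 :=
  \matrix_(r, s) (if r == s then al r else if val s == (val r).+1 then x s else 0).

Definition lomx be y : 'M[F]_d.+1 :=
  \matrix_(r, s) (if r == s then be r else if val r == (val s).+1 then y r else 0).

Lemma sum_co u (f : nat -> F) j :
  \sum_(s < d.+1) (if val s == j then f s else 0) * u s 0 = f j * co u j.
Proof.
have [ledj|ltdj] := leqP j d; last first.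
  rewrite co_out // mulr0 big1 // => s _; case: eqP => [sj|_]; last exact: mul0r.
  by have := ltn_ord s; rewrite sj ltnS leqNgt ltdj.
rewrite (bigD1 (Ordinal (ledj : (j < d.+1)%N))) //= eqxx -coE big1 ?addr0 //= => s.
by rewrite -val_eqE /= => /negPf ->; rewrite mul0r.
Qed.

Lemma co_upmx al x u j :
  co (upmx al x *m u) j = al j * co u j + x j.+1 * co u j.+1.
Proof.
have [ledj|ltdj] := leqP j d; last first.
  by rewrite !co_out ?(leqW ltdj) // !mulr0 addr0.
pose r := Ordinal (ledj : (j < d.+1)%N).
rewrite -[j]/(val r) coE mxE -!sum_co -big_split /=; apply: eq_bigr => s _.
rewrite mxE -mulrDl -val_eqE /= eq_sym; congr (_ * _).
by case: eqP => [->|_]; rewrite ?add0r // ltn_eqF ?addr0.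
Qed.

Lemma co_lomx be y u j : (j <= d)%N ->
  co (lomx be y *m u) j = be j * co u j + (if j is i.+1 then y j * co u i else 0).
Proof.
move=> ledj; pose r := Ordinal (ledj : (j < d.+1)%N).
rewrite -{1}[j]/(val r) coE mxE; transitivity (\sum_(s < d.+1)
  ((if val s == j then be s else 0) * u s 0
   + (if j == (val s).+1 then y j else 0) * u s 0)).
  apply: eq_bigr => s _; rewrite mxE -mulrDl -val_eqE /= eq_sym; congr (_ * _).
  by case: eqP => [->|_]; rewrite ?add0r // ltn_eqF ?addr0.
rewrite big_split /= sum_co; congr (_ + _).
case: (j) => [|i]; first by rewrite big1 // => s _; rewrite mul0r.
rewrite -(sum_co u (fun=> y i.+1)); apply: eq_bigr => s _.
by rewrite eqSS eq_sym.
Qed.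

(** Vanishing of [y] at both ends removes the boundary cases: at [j = 0] the junk value [0.-1 = 0]
    is multiplied by 0, and at [j = d.+1] the last coordinate does not leak out. *)
Lemma co_lomx0 be y u j : y 0%N = 0 -> y d.+1 = 0 ->
  co (lomx be y *m u) j = be j * co u j + y j * co u j.-1.
Proof.
move=> y0 yd; have [ledj|ltdj] := leqP j d.
  by rewrite co_lomx //; case: (j) => //; rewrite y0 mul0r.
rewrite !(@co_out _ j) // mulr0 add0r; case: j ltdj => // j.
rewrite ltnS leq_eqVlt => /predU1P[<-|ltdj]; first by rewrite yd mul0r.
by rewrite co_out // mulr0.
Qed.
End Bidiagonal.

Section Line.
Variables (F : numFieldType) (d : nat) (a b c : F).
Hypothesis d_even : ~~ odd d.

Definition kap : F := 2 * a * b - c * d.+1%:R.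
Definition LX : 'M[F]_d.+1 := upmx d (Otheta d a) (fun=> 1).
Definition LY : 'M[F]_d.+1 := lomx d (beta d b) (zeta d a b c).
Definition LZ : 'M[F]_d.+1 := LX *m LY + LY *m LX - kap%:M.

Lemma zeta0 : zeta d a b c 0 = 0.
Proof. by rewrite /zeta /psi /=; ring. Qed.
Lemma zetaS : zeta d a b c d.+1 = 0.
Proof. by rewrite /zeta /psi /= d_even -natr1; field. Qed.

Lemma co_LX u j : co (LX *m u) j = Otheta d a j * co u j + co u j.+1.
Proof. by rewrite co_upmx mul1r. Qed.
Lemma co_LY u j : co (LY *m u) j = beta d b j * co u j + zeta d a b c j * co u j.-1.
Proof. exact: co_lomx0 zeta0 zetaS. Qed.

Lemma LZE (u : 'cV[F]_d.+1) : LZ *m u = LX *m (LY *m u) + LY *m (LX *m u) - kap *: u.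
Proof. by rewrite mulmxBl mulmxDl !mulmxA mul_scalar_mx. Qed.

(** The constants here and in [LZY] are the cyclic images of [kap]; this symmetry later allows
    [(LZ, LX, LY)] to take the place of [(LX, LY, LZ)] with parameters [(c, a, b)]. *)
Lemma LZX (u : 'cV[F]_d.+1) : LZ *m (LX *m u) + LX *m (LZ *m u) =
  LY *m u + (2 * c * a - b * d.+1%:R) *: u.
Proof.
apply/coP=> j _; rewrite !LZE -!scaleNr !mulmxDr -!scalemxAr.
rewrite !(coD, coZ, co_LX, co_LY).
rewrite /Otheta /beta /zeta /psi /kap !sign_parity.
case: j => [|j] /=; first by field.
by rewrite -!natr1; case: (odd j) => /=; field.
Qed.

Lemma LZY (u : 'cV[F]_d.+1) : LZ *m (LY *m u) + LY *m (LZ *m u) =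
  LX *m u + (2 * b * c - a * d.+1%:R) *: u.
Proof.
apply/coP=> j _; rewrite !LZE -!scaleNr !mulmxDr -!scalemxAr.
rewrite !(coD, coZ, co_LX, co_LY).
rewrite /Otheta /beta /zeta /psi /kap !sign_parity.
case: j => [|[|j]] /=; [by field|by field|].
by rewrite -!natr1; case: (odd j) => /=; field.
Qed.
End Line.

(** * Chains of functionals *)

Section UnitVectors.
Variables (F : fieldType) (d : nat).
Implicit Types (u v : 'cV[F]_d.+1).

Definition ev (j : nat) : 'cV[F]_d.+1 := \col_s (val s == j)%:R.

Lemma co_ev r j : co (ev j) r = ((r == j) && (j <= d)%N)%:R.
Proof.
have [lerd|ltdr] := leqP r d; last first.
  by rewrite co_out //; case: eqP => //= <-; rewrite leqNgt ltdr.
rewrite -[r]/(val (Ordinal (lerd : (r < d.+1)%N))) coE mxE /=.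
by case: eqP => //= <-; rewrite lerd.
Qed.

Lemma ev_out j : (d < j)%N -> ev j = 0.
Proof.
move=> ltdj; apply/coP => i _.
by rewrite co_ev co0 [(j <= d)%N]leqNgt ltdj andbF.
Qed.

Lemma col_ev u : u = \sum_(s < d.+1) co u s *: ev s.
Proof.
apply/matrixP=> i k; rewrite ord1 summxE (bigD1 i) //= big1 => [|s /negPf si].
  by rewrite !mxE eqxx mulr1 coE addr0.
by rewrite !mxE val_eqE eq_sym si mulr0.
Qed.

Variables (A : 'M[F]_d.+1) (xi : nat -> F) (j0 : nat).

Fixpoint chain i u : F :=
  if i is j.+1 then chain j (A *m u) - xi j * chain j u else co u j0.

Lemma chainD i u v : chain i (u + v) = chain i u + chain i v.
Proof. by elim: i u v => [|i IH] u v /=; rewrite ?coD // mulmxDr !IH; ring. Qed.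

Lemma chainZ i k u : chain i (k *: u) = k * chain i u.
Proof. by elim: i u => [|i IH] u /=; rewrite ?coZ // -scalemxAr !IH; ring. Qed.

Lemma chain0 i : chain i 0 = 0.
Proof. by rewrite -(scale0r 0) chainZ mul0r. Qed.

Lemma chainA i u : chain i (A *m u) = chain i.+1 u + xi i * chain i u.
Proof. by rewrite /= subrK. Qed.

Lemma chain_ev i u : chain i u = \sum_(s < d.+1) chain i (ev s) * co u s.
Proof.
rewrite {1}(col_ev u); elim/big_rec2: _ => [|s x y _ IH]; first exact: chain0.
by rewrite chainD chainZ IH mulrC.
Qed.

(** The chain is stacked in reverse: [A] raises the index of the chain, so it becomes lower
    bidiagonal with subdiagonal 1, as [OX] requires. *)
Definition chainmx : 'M[F]_d.+1 := \matrix_(r, s) chain (d - r) (ev s).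

Lemma co_chainmx u r : (r <= d)%N -> co (chainmx *m u) r = chain (d - r) u.
Proof.
move=> led; rewrite -[r]/(val (Ordinal (led : (r < d.+1)%N))) coE mxE chain_ev.
by apply: eq_bigr => s _; rewrite mxE coE.
Qed.
End UnitVectors.
Arguments chain : simpl never.

Section Universal.
Variables (F : numFieldType) (d : nat) (a b c : F) (A B C : 'M[F]_d.+1) (j0 : nat).
Hypothesis d_even : ~~ odd d.
Local Notation g := (chain A (beta d a) j0).

Hypothesis C_def : forall u : 'cV_d.+1,
  C *m u = A *m (B *m u) + B *m (A *m u) - (2 * a * b - c * d.+1%:R) *: u.
Hypothesis CA : forall u : 'cV_d.+1,
  C *m (A *m u) + A *m (C *m u) = B *m u + (2 * c * a - b * d.+1%:R) *: u.
Hypothesis g0B : forall u : 'cV_d.+1, g 0 (B *m u) = beta d b 0 * g 0 u.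
Hypothesis g1B : forall u : 'cV_d.+1,
  g 1 (B *m u) = beta d b 1 * g 1 u + psi d a b c 1 * g 0 u.

Lemma psi0 : psi d a b c 0 = 0.
Proof. by rewrite /psi /=; ring. Qed.

Lemma psiS : psi d a b c d.+1 = 0.
Proof. by rewrite /psi /= d_even -natr1; field. Qed.

(** Comparing [g i] of both sides of [CA] gives a three-term recursion for [g i (B *m u)]. *)
Lemma chainB i (u : 'cV_d.+1) :
  g i (B *m u) = beta d b i * g i u + psi d a b c i * g i.-1 u.
Proof.
suff: (forall u, g i (B *m u) = beta d b i * g i u + psi d a b c i * g i.-1 u)
  /\ (forall u, g i.+1 (B *m u) = beta d b i.+1 * g i.+1 u + psi d a b c i.+1 * g i u).
  by case.
elim: i => [|i [IH0 IH1]] {u}.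
  by split=> u; rewrite ?psi0 ?mul0r ?addr0.
split=> // u; have := congr1 (g i) (CA u).
rewrite !C_def -!scaleNr !mulmxDr -!scalemxAr.
rewrite !(chainD, chainZ, chainA, IH0, IH1).
case: i {IH0 IH1} => [|i] /= E.
- apply/eqP; rewrite -subr_eq0; apply/eqP; move/eqP: E; rewrite -subr_eq0 => /eqP <-.
  by rewrite /beta /psi !sign_parity /= -!natr1; field.
- apply/eqP; rewrite -subr_eq0; apply/eqP; move/eqP: E; rewrite -subr_eq0 => /eqP <-.
  by rewrite /beta /psi !sign_parity /= -!natr1; case: (odd i) => /=; field.
Qed.
End Universal.

(** * Similarity and irreducibility *)

Section Similarity.
Variables (F : fieldType) (m : nat).
Implicit Types (T X Y Z : 'M[F]_m) (S : 'cV[F]_m -> Prop).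

Lemma inj_unitmx T : (forall u : 'cV_m, T *m u = 0 -> u = 0) -> T \in unitmx.
Proof.
move=> injT; rewrite -unitmx_tr -row_free_unit; apply: inj_row_free => v vT0.
by apply: trmx_inj; rewrite trmx0; apply: injT; rewrite -[T]trmxK -trmx_mul vT0 trmx0.
Qed.

Definition subspace S := S 0 /\ forall (k : F) u w, S u -> S w -> S (k *: u + w).

Definition stable X S := forall u, S u -> S (X *m u).

(** Two matrices are enough to carry irreducibility around, because in the modules below each of the
    three generators is a polynomial in the other two; different pairs are used for different
    comparisons. *)
Definition irr_pair X Y := forall S,
  subspace S -> stable X S -> stable Y S -> (forall u, S u -> u = 0) \/ (forall u, S u).

Lemma subspaceZ S k u : subspace S -> S u -> S (k *: u).
Proof. by move=> [S0 Slin] Su; rewrite -[_ *: u]addr0; apply: Slin. Qed.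

Lemma subspaceD S u w : subspace S -> S u -> S w -> S (u + w).
Proof. by move=> [S0 Slin] Su Sw; rewrite -[u]scale1r; apply: Slin. Qed.

Lemma subspaceB S u w : subspace S -> S u -> S w -> S (u - w).
Proof. by move=> sS Su Sw; rewrite -scaleN1r; do ?[exact: subspaceZ|apply: subspaceD]. Qed.

Lemma irr_pair_sim T X Y X' Y' : T \in unitmx ->
  T *m X = X' *m T -> T *m Y = Y' *m T -> irr_pair X Y -> irr_pair X' Y'.
Proof.
move=> uT TX TY irrXY S [S0 Slin] SX SY.
have [|u Su|u Su|TS0|TST] := irrXY (fun u => S (T *m u)).
- split=> [|k u w Su Sw]; first by rewrite mulmx0.
  by rewrite mulmxDr -scalemxAr; apply: Slin.
- by rewrite mulmxA TX -mulmxA; apply: SX.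
- by rewrite mulmxA TY -mulmxA; apply: SY.
- left=> u Su; rewrite -[u](mulKVmx uT) [X in _ *m X]TS0 ?mulmx0 //.
  by rewrite mulKVmx.
- by right=> u; rewrite -[u](mulKVmx uT); apply: TST.
Qed.

(** Schur's argument: the kernel of an intertwiner is invariant. It serves for the chain of the
    tridiagonal [LZ], where invertibility cannot be read off a triangular shape. *)
Lemma sim_inj_of_irr T X Y X' Y' : irr_pair X Y ->
  T *m X = X' *m T -> T *m Y = Y' *m T -> T != 0 -> T \in unitmx.
Proof.
move=> irrXY TX TY Tneq0; apply: inj_unitmx.
have [|u Tu|u Tu|//|T0] := irrXY (fun u => T *m u = 0).
- split=> [|k u w Tu Tw]; first by rewrite mulmx0.
  by rewrite mulmxDr -scalemxAr Tu Tw scaler0 addr0.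
- by rewrite mulmxA TX -mulmxA Tu mulmx0.
- by rewrite mulmxA TY -mulmxA Tu mulmx0.
case/eqP: Tneq0; apply/matrixP=> i j.
by have /matrixP/(_ i 0) := T0 (delta_mx j 0); rewrite -colE !mxE.
Qed.

Lemma bi_irreducible_pair X Y Z : (0 < m)%N -> irr_pair X Y -> bi_irreducible (BIMod X Y Z).
Proof.
move=> m_gt0 irrXY; split=> // S S0 Slin SXYZ.
by apply: irrXY => // u /SXYZ[? []].
Qed.
End Similarity.

Section Parity.
Variables (F : numFieldType) (d : nat).
Hypothesis d_even : ~~ odd d.

Lemma beta_sub (a : F) r : (r <= d)%N -> beta d a (d - r) = Otheta d a r.
Proof.
move=> led; rewrite /beta /Otheta !sign_parity natrB // oddB // (negPf d_even) /=.
by case: (odd r); field.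
Qed.

Lemma psi_sub (a b c : F) r : (r <= d)%N -> psi d a b c (d - r) = Ophi d a b c r.+1.
Proof.
move=> led; rewrite /psi /Ophi natrB // oddB // (negPf d_even) /= -natr1.
by case: (odd r) => /=; field.
Qed.
End Parity.

Section Split.
Variables (F : numFieldType) (d : nat) (a b c : F) (A B : 'M[F]_d.+1) (j0 : nat).
Hypothesis d_even : ~~ odd d.
Local Notation g := (chain A (beta d a) j0).
Hypothesis gB : forall i (u : 'cV_d.+1),
  g i (B *m u) = beta d b i * g i u + psi d a b c i * g i.-1 u.
Hypothesis g_end : forall u : 'cV_d.+1, g d.+1 u = 0.

Local Notation T := (chainmx A (beta d a) j0).

Lemma chainmx_OX : T *m A = OX d a *m T.
Proof.
suff TA (u : 'cV_d.+1) : T *m (A *m u) = OX d a *m (T *m u).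
  apply/matrixP=> i j; have /matrixP/(_ i 0) := TA (delta_mx j 0).
  by rewrite !mulmxA -!colE !mxE.
apply/coP=> r led; rewrite -[OX d a]/(lomx d (Otheta d a) (fun=> 1)).
rewrite co_lomx // !co_chainmx // chainA beta_sub // addrC; congr (_ + _).
case: r led => [|r] led; first by rewrite subn0 g_end.
by rewrite co_chainmx ?(ltnW led) // mul1r subnSK.
Qed.

Lemma chainmx_OY : T *m B = OY d a b c *m T.
Proof.
suff TB (u : 'cV_d.+1) : T *m (B *m u) = OY d a b c *m (T *m u).
  apply/matrixP=> i j; have /matrixP/(_ i 0) := TB (delta_mx j 0).
  by rewrite !mulmxA -!colE !mxE.
apply/coP=> r led; rewrite -[OY d a b c]/(upmx d (Othetas d b) (Ophi d a b c)).
rewrite co_upmx ![co _ r]co_chainmx // gB beta_sub // psi_sub //; congr (_ + _).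
have [ltrd|ledr] := ltnP r d; first by rewrite co_chainmx // subnS.
rewrite co_out // mulr0 -psi_sub // (_ : d - r = 0)%N ?psi0 ?mul0r //.
by apply/eqP; rewrite subn_eq0.
Qed.
End Split.

Section LineUnitVectors.
Variables (F : numFieldType) (d : nat) (a b c : F).
Hypothesis d_even : ~~ odd d.

Lemma LX_ev j : LX d a *m ev F d j =
  Otheta d a j *: ev F d j + (if j is i.+1 then if (j <= d)%N then ev F d i else 0 else 0).
Proof.
apply/coP=> i led; rewrite co_LX coD coZ !co_ev; congr (_ + _).
  by case: eqP => [->|] //=; rewrite !mulr0.
case: j => [|j]; first by rewrite co0.
rewrite eqSS; case: ifP => lejd; rewrite ?co0 ?andbF // co_ev andbT (ltnW lejd) andbT //.
Qed.

Lemma LY_ev j : LY d a b c *m ev F d j =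
  beta d b j *: ev F d j + zeta d a b c j.+1 *: ev F d j.+1.
Proof.
apply/coP=> i led; rewrite co_LY // coD !coZ !co_ev; congr (_ + _).
  by case: eqP => [->|] //=; rewrite !mulr0.
case: i led => [|i] led /=; first by rewrite zeta0 mul0r mulr0.
rewrite eqSS; case: eqP => [ij|_] /=; rewrite ?mulr0 //.
by move: led; rewrite ij => ltjd; rewrite ltjd (ltnW ltjd).
Qed.
End LineUnitVectors.

Section ReversedSplit.
Variables (F : numFieldType) (d : nat) (a b c : F) (A B : 'M[F]_d.+1) (j0 : nat).
Hypothesis d_even : ~~ odd d.
Local Notation g := (chain A (beta d a) j0).
Hypothesis gB : forall i (u : 'cV_d.+1),
  g i (B *m u) = beta d b i * g i u + psi d a b c i * g i.-1 u.
Hypothesis g_end : forall u : 'cV_d.+1, g d.+1 u = 0.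
Hypothesis psi_neq0 : forall j, (0 < j <= d)%N -> psi d a b c j != 0.

(** Normalises to 1 the entries [- psi] that [- B] has below the diagonal when the chain is read in
    its own order. *)
Definition rescale (r : nat) : F := \prod_(i < r) (- psi d a b c i.+1)^-1.

Definition rchainmx : 'M[F]_d.+1 := \matrix_(r, s) (rescale r * g r (ev F d s)).

Lemma co_rchainmx u r : (r <= d)%N -> co (rchainmx *m u) r = rescale r * g r u.
Proof.
move=> led; rewrite -[r]/(val (Ordinal (led : (r < d.+1)%N))) coE mxE chain_ev.
by rewrite mulr_sumr; apply: eq_bigr => s _; rewrite mxE coE mulrA.
Qed.

Lemma rescaleS r : (r < d)%N -> rescale r = - psi d a b c r.+1 * rescale r.+1.
Proof.
by move=> ltd; rewrite /rescale big_ord_recr /= mulrCA divff ?mulr1 // oppr_eq0 psi_neq0.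
Qed.

(** Read forwards, the chain makes [B] lower and [A] upper bidiagonal, so their roles are exchanged;
    the sign is forced by [- beta d b r = Otheta d (- b) r]. *)
Lemma rchainmx_OX : rchainmx *m (- B) = OX d (- b) *m rchainmx.
Proof.
suff TB (u : 'cV_d.+1) : rchainmx *m (- B *m u) = OX d (- b) *m (rchainmx *m u).
  apply/matrixP=> i j; have /matrixP/(_ i 0) := TB (delta_mx j 0).
  by rewrite !mulmxA -!colE !mxE.
apply/coP=> r led; rewrite -[OX d _]/(lomx d (Otheta d (- b)) (fun=> 1)).
rewrite co_lomx // mulNmx mulmxN -scaleN1r coZ ![co _ r]co_rchainmx // gB.
case: r led => [|r] led.
  by rewrite psi0 /beta /Otheta; ring.
rewrite co_rchainmx ?(ltnW led) // [rescale r]rescaleS //= /beta /Otheta.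
by field.
Qed.

Lemma rchainmx_OY : rchainmx *m (- A) = OY d (- b) (- a) c *m rchainmx.
Proof.
suff TA (u : 'cV_d.+1) : rchainmx *m (- A *m u) = OY d (- b) (- a) c *m (rchainmx *m u).
  apply/matrixP=> i j; have /matrixP/(_ i 0) := TA (delta_mx j 0).
  by rewrite !mulmxA -!colE !mxE.
apply/coP=> r led.
rewrite -[OY d _ _ _]/(upmx d (Othetas d (- a)) (Ophi d (- b) (- a) c)).
rewrite co_upmx mulNmx mulmxN -scaleN1r coZ ![co _ r]co_rchainmx // chainA.
rewrite (_ : Ophi d (- b) (- a) c r.+1 = psi d a b c r.+1); last first.
  by rewrite /Ophi /psi /= -natr1; case: (odd r) => /=; field.
have [ltrd|ledr] := ltnP r d.
  by rewrite co_rchainmx // [rescale r]rescaleS //= /beta /Othetas; field.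
have -> : r = d by apply/eqP; rewrite eqn_leq led ledr.
by rewrite g_end psiS //= /beta /Othetas; field.
Qed.
End ReversedSplit.

Definition bi_sim (F : fieldType) m (X Y Z X' Y' Z' : 'M[F]_m) :=
  exists2 T, T \in unitmx & [/\ T *m X = X' *m T, T *m Y = Y' *m T & T *m Z = Z' *m T].

Lemma bi_sim_O (F : fieldType) d (a b c : F) (T X Y Z : 'M[F]_d.+1) :
  T \in unitmx -> Z = X *m Y + Y *m X - (2 * a * b - c * d.+1%:R)%:M ->
  T *m X = OX d a *m T -> T *m Y = OY d a b c *m T ->
  bi_sim X Y Z (OX d a) (OY d a b c) (OZ d a b c).
Proof.
move=> uT -> TX TY; exists T => //; split=> //; rewrite /OZ.
rewrite mulmxBr mulmxDr mulmxBl mulmxDl !mulmxA TX TY -!mulmxA TX TY !mulmxA.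
by rewrite mul_mx_scalar mul_scalar_mx.
Qed.

(** * Identification of bidiagonal modules with [O_d] *)

Section LineToO.
Variables (F : numFieldType) (d : nat) (a b c : F).
Hypothesis d_even : ~~ odd d.
Local Notation LX := (LX d a).
Local Notation LY := (LY d a b c).
Local Notation LZ := (LZ d a b c).
Local Notation g := (chain LX (beta d a) 0).

Lemma line_chainB i (u : 'cV_d.+1) :
  g i (LY *m u) = beta d b i * g i u + psi d a b c i * g i.-1 u.
Proof.
apply: (chainB (C := LZ)) => // {i}{}u.
- exact: LZE.
- exact: LZX.
- by rewrite /chain co_LY // zeta0 mul0r addr0.
- rewrite /chain !co_LX !co_LY //= zeta0 /zeta /beta /Otheta /psi /=.
  by field.
Qed.

(** Each factor [LX - beta] moves coordinates down by one place with coefficient 1, so the chain is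
    unitriangular in the coordinates; injectivity of the whole chain follows. *)
Lemma line_chain_tri i (u : 'cV_d.+1) : (forall j, (j < i)%N -> co u j = 0) -> g i u = co u i.
Proof.
elim: i u => [//|i IH] u u0; rewrite -[LHS]/(g i (LX *m u) - beta d a i * g i u).
rewrite !IH => [||j ji]; first by rewrite co_LX u0 // !mulr0 add0r subr0.
  by move=> j ji; rewrite u0 // ltnS ltnW.
by rewrite co_LX !u0 ?mulr0 ?addr0 // ltnS ltnW.
Qed.

Lemma line_chain_inj (u : 'cV_d.+1) : (forall i, (i <= d)%N -> g i u = 0) -> u = 0.
Proof.
move=> gu0; apply/coP=> j; rewrite co0; have [n] := ubnP j.
elim: n j => // n IH j; rewrite ltnS => lejn lejd.
rewrite -line_chain_tri ?gu0 // => i ltij; apply: IH; first exact: leq_trans lejn.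
exact: leq_trans (ltnW ltij) lejd.
Qed.

Hypothesis beta_end : forall j, (j <= d)%N -> beta d b d.+1 != beta d b j.

(** Since [psi] vanishes at [d.+1], the functional [g d.+1] is a left eigenvector of [LY] with
    eigenvalue [beta d b d.+1]. This differs from every diagonal entry of the triangular matrix
    [LY], so the functional is 0. *)
Lemma line_chain_end (u : 'cV_d.+1) : g d.+1 u = 0.
Proof.
suff g_ev k j : (j + k = d.+1)%N -> g d.+1 (ev F d j) = 0.
  rewrite chain_ev big1 // => s _; rewrite (g_ev (d.+1 - s)%N) ?mul0r //.
  by rewrite subnKC // ltnW.
elim: k j => [|k IH] j jk; first by rewrite ev_out ?chain0 -?jk ?addn0.
have := line_chainB d.+1 (ev F d j).
rewrite LY_ev // chainD !chainZ (IH j.+1) ?addSnnS // psiS // mul0r mulr0 !addr0.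
move/eqP; rewrite -subr_eq0 -mulrBl mulf_eq0 subr_eq0 eq_sym.
have lejd : (j <= d)%N by rewrite -ltnS -jk addnS ltnS leq_addr.
by rewrite (negPf (beta_end lejd)) => /eqP.
Qed.

Hypothesis psi_neq0 : forall j, (0 < j <= d)%N -> psi d a b c j != 0.
Hypothesis zeta_neq0 : forall j, (0 < j <= d)%N -> zeta d a b c j != 0.
Hypothesis theta_simple : forall j, (0 < j <= d)%N -> Otheta d a j != Otheta d a 0.

Lemma line_irreducible : irr_pair LX LY.
Proof.
move=> S sS SX SY; have [[u [Su nzu]]|nz] := EM (exists u, S u /\ u <> 0); last first.
  by left=> u Su; apply: contrapT => nzu; apply: nz; exists u.
right.
have [i [leid giu]] : exists i, (i <= d)%N /\ g i u <> 0.
  apply: contrapT => nex; apply: nzu; apply: line_chain_inj => i leid.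
  by apply: contrapT => giu; apply: nex; exists i.
(* [LY] climbs the chain: if [g i.+1 u] vanishes, then [g i.+1] takes at [LY *m u] the value
   [psi d a b c i.+1 * g i u], which is nonzero. *)
have {i leid u Su nzu giu} [u Su gdu] : exists2 u, S u & g d u != 0.
  have [k] := ubnP (d - i)%N; move/eqP: giu; elim: k i u leid Su {nzu} => // k IH i u.
  rewrite leq_eqVlt => /predU1P[->|ltid] Su giu; first by exists u.
  rewrite ltnS => lek; have lt_ik : (d - i.+1 < k)%N.
    by apply: leq_trans lek; rewrite subnS prednK // subn_gt0.
  have [gSu|gSu] := eqVneq (g i.+1 u) 0; last exact: (IH i.+1 u).
  apply: (IH i.+1 (LY *m u)) => //; first exact: SY.
  by rewrite line_chainB gSu mulr0 add0r mulf_neq0 // psi_neq0.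
have gdX (v : 'cV_d.+1) : g d (LX *m v) = Otheta d a 0 * g d v.
  by rewrite chainA line_chain_end add0r -(beta_sub d_even) // subn0.
(* The factors [LX - Otheta d a (d - k)] clear the coordinates from the top down to index 1. Each
   multiplies [g d] by [Otheta d a 0 - Otheta d a (d - k)], so [g d] stays nonzero and a nonzero
   multiple of [ev F d 0] remains. *)
have {u Su gdu} [u [Su gdu uj]] :
    exists u, [/\ S u, g d u != 0 & forall j, (0 < j)%N -> co u j = 0].
  suff: forall k, (k <= d)%N ->
      exists u, [/\ S u, g d u != 0 & forall j, (d - k < j)%N -> co u j = 0].
    by move=> /(_ d (leqnn d)); rewrite subnn.
  elim=> [|k IH] lekd.
    by exists u; split=> // j; rewrite subn0; exact: co_out.
  have [v [Sv gdv vj]] := IH (ltnW lekd).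
  exists (LX *m v - Otheta d a (d - k) *: v); split.
  - by apply: subspaceB (SX _ Sv) _ => //; apply: subspaceZ.
  - rewrite -scaleNr chainD chainZ gdX -mulrDl mulf_neq0 // subr_eq0 eq_sym.
    by apply: theta_simple; rewrite subn_gt0 lekd leq_subr.
  - move=> j; rewrite subnS => ltj.
    have {ltj}: (d - k <= j)%N by case: (d - k)%N ltj.
    rewrite -scaleNr coD coZ co_LX leq_eqVlt => /predU1P[<-|ltj].
      by rewrite [co v _.+1]vj // addr0 mulNr subrr.
    by rewrite !vj ?(ltnW ltj) ?mulr0 ?addr0 // ltnS ltnW.
have {gdu uj} Sev0 : S (ev F d 0).
  have uE : u = co u 0 *: ev F d 0.
    apply/coP=> j _; rewrite coZ co_ev andbT.
    by case: j => [|j]; rewrite ?mulr1 // uj ?mulr0.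
  have nz0 : co u 0 != 0.
    by apply: contraNneq gdu => u0; rewrite uE u0 scale0r chain0.
  move: (co u 0) uE nz0 => k uE nz0.
  have -> : ev F d 0 = k^-1 *: u by rewrite uE scalerA mulVf // scale1r.
  exact: subspaceZ.
have Sev j : (j <= d)%N -> S (ev F d j).
  elim: j => [//|j IH] ltjd; have Sj := IH (ltnW ltjd).
  have -> : ev F d j.+1 = (zeta d a b c j.+1)^-1 *: (LY *m ev F d j - beta d b j *: ev F d j).
    by rewrite LY_ev // addrC addKr scalerA mulVf ?scale1r ?zeta_neq0.
  apply: subspaceZ => //; apply: subspaceB (SY _ Sj) _ => //.
  exact: subspaceZ.
move=> w; rewrite (col_ev w); elim/big_rec: _ => [|s v _ Sv]; first by case: sS.
apply: subspaceD Sv => //; apply: subspaceZ => //.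
by apply: Sev; rewrite -ltnS.
Qed.

Lemma line_sim_O :
  bi_sim LX LY LZ (OX d a) (OY d a b c) (OZ d a b c) /\ irr_pair (OX d a) (OY d a b c).
Proof.
pose T := chainmx LX (beta d a) 0.
have uT : T \in unitmx.
  apply: inj_unitmx => u Tu; apply: line_chain_inj => i leid.
  by rewrite -(subKn leid) -co_chainmx ?leq_subr // -/T Tu co0.
have TX : T *m LX = OX d a *m T by exact/chainmx_OX/line_chain_end.
have TY : T *m LY = OY d a b c *m T by exact/chainmx_OY/line_chainB.
split; last exact: irr_pair_sim uT TX TY line_irreducible.
exact: bi_sim_O uT _ TX TY.
Qed.

(** The substitution of [(- Y, - X, Z)] for [(X, Y, Z)] preserves the shape of the relations, and
    the constant of the first one does not change because [2 * a * b] is even in the pair of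
    signs. *)
Lemma line_sim_O_swap :
  bi_sim (- LY) (- LX) LZ (OX d (- b)) (OY d (- b) (- a) c) (OZ d (- b) (- a) c)
  /\ irr_pair (OX d (- b)) (OY d (- b) (- a) c).
Proof.
pose T := rchainmx a b c LX 0.
have T_neq0 i : (i <= d)%N -> rescale d a b c i != 0.
  move=> led; rewrite /rescale prodf_seq_neq0; apply/allP=> j _ /=.
  by rewrite invr_eq0 oppr_eq0 psi_neq0 //= (leq_trans (ltn_ord j)).
have uT : T \in unitmx.
  apply: inj_unitmx => u Tu; apply: line_chain_inj => i leid.
  apply/eqP; rewrite -[_ == 0]orFb -(negPf (T_neq0 i leid)) -mulf_eq0.
  by rewrite -co_rchainmx // -/T Tu co0.
have TX : T *m (- LY) = OX d (- b) *m T by apply: rchainmx_OX line_chainB _.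
have TY : T *m (- LX) = OY d (- b) (- a) c *m T.
  by apply: rchainmx_OY line_chain_end _.
split.
  apply: bi_sim_O uT _ TX TY; rewrite /LZ /kap !mulNmx !mulmxN !opprK [X in _ = X - _]addrC.
  by rewrite (_ : 2 * - b * - a = 2 * a * b); last ring.
apply: irr_pair_sim uT TX TY _ => S sS SX SY; apply: line_irreducible => // u Su.
  by rewrite -[LX *m u]opprK -mulNmx -scaleN1r; apply: subspaceZ (SY _ Su).
by rewrite -[LY *m u]opprK -mulNmx -scaleN1r; apply: subspaceZ (SX _ Su).
Qed.

Hypothesis beta_end_theta : forall j, (j <= d)%N -> beta d a d.+1 != Otheta d a j.

(** The chain now consists of factors in [LZ] and starts from coordinate [d], which is a left
    eigenvector of the upper bidiagonal [LX]; [LY] is recovered from the other two through [LZX]. *)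
Lemma line_sim_O_rot :
  bi_sim LZ LX LY (OX d c) (OY d c a b) (OZ d c a b) /\ irr_pair (OX d c) (OY d c a b).
Proof.
have LYE (u : 'cV_d.+1) :
    LY *m u = LZ *m (LX *m u) + LX *m (LZ *m u) - (2 * c * a - b * d.+1%:R) *: u.
  by rewrite LZX // addrK.
have hB i (u : 'cV_d.+1) : chain LZ (beta d c) d i (LX *m u) =
    beta d a i * chain LZ (beta d c) d i u + psi d c a b i * chain LZ (beta d c) d i.-1 u.
  apply: (chainB (C := LY)) => // {i}{}u.
  - by rewrite addrC LZY.
  - rewrite /chain co_LX [co _ d.+1]co_out // addr0; congr (_ * _).
    by rewrite -(beta_sub d_even) // subnn.
  - rewrite /chain !LZE -!scaleNr.
    rewrite !(coD, coZ, co_LX, co_LY) // !(@co_out _ _ _ d.+1) // !(@co_out _ _ _ d.+2) //.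
    rewrite /Otheta /beta /zeta /psi /kap !sign_parity.
    have ud : co u d.+1 = 0 by exact: co_out.
    move: d_even; case: (d) (co u) ud => [|e] f ud; rewrite /= ud -?natr1 => even_e.
      by field.
    by case: (odd e) even_e => //= _; field.
have hend (u : 'cV_d.+1) : chain LZ (beta d c) d d.+1 u = 0.
  suff h_ev j : chain LZ (beta d c) d d.+1 (ev F d j) = 0.
    by rewrite chain_ev big1 // => s _; rewrite h_ev mul0r.
  have [lejd|ltdj] := leqP j d; last by rewrite ev_out ?chain0.
  elim: j lejd => [|j IH] lejd.
    have := hB d.+1 (ev F d 0); rewrite LX_ev addr0 chainZ psiS // mul0r addr0.
    move/eqP; rewrite -subr_eq0 -mulrBl mulf_eq0 subr_eq0 eq_sym.
    by rewrite (negPf (beta_end_theta lejd)) => /eqP.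
  have := hB d.+1 (ev F d j.+1).
  rewrite LX_ev lejd chainD chainZ (IH (ltnW lejd)) psiS // mul0r !addr0.
  move/eqP; rewrite -subr_eq0 -mulrBl mulf_eq0 subr_eq0 eq_sym.
  by rewrite (negPf (beta_end_theta lejd)) => /eqP.
pose T := chainmx LZ (beta d c) d.
have TX : T *m LZ = OX d c *m T by exact: chainmx_OX hend.
have TY : T *m LX = OY d c a b *m T by exact: chainmx_OY hB.
have irr : irr_pair LZ LX.
  move=> S sS SZ SX; apply: line_irreducible => // u Su.
  rewrite LYE; apply: subspaceB; first exact: sS.
    by apply: subspaceD => //; [apply/SZ/SX|apply/SX/SZ].
  exact: subspaceZ.
(* The last row of [T] is the coordinate [d] itself, so [T] is not 0 and irreducibility makes it
   invertible. *)
have uT : T \in unitmx.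
  apply: sim_inj_of_irr irr TX TY _; apply/eqP => T0.
  have := co_chainmx LZ (beta d c) d (ev F d d) (leqnn d).
  rewrite -/T T0 mul0mx co0 subnn /chain co_ev eqxx leqnn /= => /esym/eqP.
  by rewrite oner_eq0.
split; last exact: irr_pair_sim uT TX TY irr.
apply: bi_sim_O uT _ TX TY; apply/matrixP => i j.
have /matrixP/(_ i 0) := LYE (delta_mx j 0).
by rewrite !mulmxA -mulmxDl -mul_scalar_mx -mulmxBl -!colE !mxE.
Qed.
End LineToO.

(** * Coefficients of spinor polynomials *)

Section PolynomialCoefficients.
Variables (R : realType) (k : 'I_3 -> R).
Local Notation C := (R[i]).
Local Notation P := {mpoly C[3]}.
Implicit Types (f g : P) (m : 'X_{1..3}) (i : 'I_3).

(** [T_i x_i^j = lam i j x_i^(j - 1)]. *)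
Definition lam i (j : nat) : C := j%:R + (if odd j then 2 * rc (k i) else 0).

Lemma mcoeff_divX i f m : (divX i f)@_m = f@_(m + U_(i)).
Proof.
rewrite /divX [in RHS](mpolyE f) !raddf_sum [LHS]big_mkcond; apply: eq_bigr => m' _ /=.
rewrite [in RHS]mcoeffZ mcoeffX; case: posnP => [m'0|m'gt0].
  rewrite (_ : (m' == _) = false) ?mulr0 //; apply/eqP => /(congr1 (fun m => m i)).
  by rewrite mnmDE mnm1E eqxx addn1 m'0.
rewrite mcoeffZ mcoeffX; congr (_ * (nat_of_bool _)%:R).
apply/eqP/eqP => [<-|->]; first by rewrite submK // lep1mP -lt0n.
by rewrite addmK.
Qed.

Lemma reflX i m : refl i 'X_[C, m] = (-1) ^+ m i *: 'X_[m].
Proof.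
rewrite /refl comp_mpolyX mpolyXE_id (bigD1 i) //= [in RHS](bigD1 i) //=.
rewrite tnth_mktuple eqxx (exprNn ('X_i : P)) -mulrA -signr_odd -[in RHS]signr_odd.
rewrite (_ : \prod_(_ < _ | _) _ = \prod_(j < 3 | j != i) 'X_j ^+ m j); last first.
  by apply: eq_bigr => j /negPf nij; rewrite tnth_mktuple nij.
by case: (odd _); rewrite ?expr1 ?expr0 ?mulN1r ?scaleN1r ?mul1r ?scale1r.
Qed.

Lemma mcoeff_refl i f m : (refl i f)@_m = (-1) ^+ m i * f@_m.
Proof.
rewrite [in LHS]/refl comp_mpolyEX [in RHS](mpolyE f) !raddf_sum mulr_sumr.
apply: eq_bigr => m' _ /=; rewrite -/(refl i _) reflX !mcoeffZ mcoeffX.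
by case: eqP => [->|]; rewrite ?mulr0 // mulrCA.
Qed.

Lemma mcoeff_dunkl i f m : (dunkl k i f)@_m = lam i (m i).+1 * f@_(m + U_(i)).
Proof.
rewrite /dunkl mcoeffD mcoeff_deriv mcoeffZ mcoeff_divX mcoeffB mcoeff_refl /lam.
rewrite mnmDE mnm1E eqxx addn1 -signr_odd /= -mulr_natl.
by case: (odd _); rewrite /= ?expr0 ?expr1; ring.
Qed.

Lemma mcoeffXM i f m :
  ('X_i * f)@_m = if (0 < m i)%N then f@_(m - U_(i)) else 0.
Proof.
case: posnP => [m0|mgt0]; last first.
  by rewrite -{1}[m](@submK _ U_(i)) ?lep1mP -?lt0n // -commr_mpolyX addmC mcoeffMX.
rewrite (mpolyE f) mulr_sumr raddf_sum big1 // => m' _ /=.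
rewrite -scalerAr -mpolyXD mcoeffZ mcoeffX; case: eqP => [m'E|_]; last by rewrite mulr0.
by move: m0; rewrite -m'E mnmDE mnm1E eqxx.
Qed.
End PolynomialCoefficients.

Section Spinors.
Variables (R : realType) (k : 'I_3 -> R).
Local Notation C := (R[i]).
Local Notation V := (V R).
Implicit Types (v w : V) (s : C * C).

Definition cyc (q1 q2 p : 'I_3) : Prop :=
  [\/ [/\ q1 = 0, q2 = 1 & p = 2], [/\ q1 = 1, q2 = 2 & p = 0]
    | [/\ q1 = 2, q2 = 0 & p = 1]].

(** [spin p] are coordinates in an eigenbasis of [sigma_p], scaled so that the formulas below do
    not depend on which cyclic rotation [(q1, q2, p)] of [(0, 1, 2)] is taken. *)
Definition spin (p : 'I_3) s : C * C :=
  match val p with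
  | 0 => (s.1 + s.2, 'i * (s.1 - s.2))
  | 1 => (s.1 - 'i * s.2, s.1 + 'i * s.2)
  | _ => s
  end.

Definition unspin (p : 'I_3) s : C * C :=
  match val p with
  | 0 => ((s.1 - 'i * s.2) / 2, (s.1 + 'i * s.2) / 2)
  | 1 => ((s.1 + s.2) / 2, 'i * (s.1 - s.2) / 2)
  | _ => s
  end.

Lemma ii : 'i * 'i = -1 :> C.
Proof. by rewrite -expr2 sqrCi. Qed.

Lemma unspinK p : cancel (unspin p) (spin p).
Proof.
have h := ii; case=> x y; rewrite /spin /unspin; case: (val p) => [|[|n]] //=.
  by congr (_, _); field: h.
by congr (_, _); field: h.
Qed.

Lemma spinK p : cancel (spin p) (unspin p).
Proof.
have h := ii; case=> x y; rewrite /spin /unspin; case: (val p) => [|[|n]] //=.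
  by congr (_, _); field: h.
by congr (_, _); field: h.
Qed.
End Spinors.

Section Monomials.
Variables (q1 q2 p : 'I_3).

Definition mon (a b c : nat) : 'X_{1..3} := (U_(q1) *+ a + U_(q2) *+ b + U_(p) *+ c)%MM.

Lemma mdeg_mon a b c : mdeg (mon a b c) = (a + b + c)%N.
Proof. by rewrite /mon !mdegD !mdegMn !mdeg1 !mul1n. Qed.

Hypotheses (n12 : q1 != q2) (n1p : q1 != p) (n2p : q2 != p).

Lemma mon1 a b c : mon a b c q1 = a.
Proof.
by rewrite /mon !mnmDE !mulmnE !mnm1E eqxx ![_ == q1]eq_sym (negPf n12) (negPf n1p); lia.
Qed.

Lemma mon2 a b c : mon a b c q2 = b.
Proof.
by rewrite /mon !mnmDE !mulmnE !mnm1E eqxx [p == q2]eq_sym (negPf n12) (negPf n2p); lia.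
Qed.

Lemma mon3 a b c : mon a b c p = c.
Proof.
by rewrite /mon !mnmDE !mulmnE !mnm1E eqxx (negPf n1p) (negPf n2p); lia.
Qed.

Lemma monU1 a b c : (mon a b c + U_(q1))%MM = mon a.+1 b c.
Proof. by apply/mnmP => i; rewrite /mon !mnmDE !mulmnE; lia. Qed.
Lemma monU2 a b c : (mon a b c + U_(q2))%MM = mon a b.+1 c.
Proof. by apply/mnmP => i; rewrite /mon !mnmDE !mulmnE; lia. Qed.
Lemma monU3 a b c : (mon a b c + U_(p))%MM = mon a b c.+1.
Proof. by apply/mnmP => i; rewrite /mon !mnmDE !mulmnE; lia. Qed.

Lemma monB1 a b c : (0 < a)%N -> (mon a b c - U_(q1))%MM = mon a.-1 b c.
Proof. by case: a => // a _; rewrite -monU1 addmK. Qed.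
Lemma monB2 a b c : (0 < b)%N -> (mon a b c - U_(q2))%MM = mon a b.-1 c.
Proof. by case: b => // b _; rewrite -monU2 addmK. Qed.
Lemma monB3 a b c : (0 < c)%N -> (mon a b c - U_(p))%MM = mon a b c.-1.
Proof. by case: c => // c _; rewrite -monU3 addmK. Qed.

Lemma monE (m : 'X_{1..3}) : m = mon (m q1) (m q2) (m p).
Proof.
apply/mnmP=> i; have : i \in [:: q1; q2; p].
  move: i q1 q2 p n12 n1p n2p.
  by do 4!case=> [[|[|[|//]]] ?].
by rewrite !inE => /or3P[] /eqP ->; rewrite ?mon1 ?mon2 ?mon3.
Qed.
End Monomials.

Lemma cyc_neq (q1 q2 p : 'I_3) : cyc q1 q2 p -> [/\ q1 != q2, q1 != p & q2 != p].
Proof. by case=> -[-> -> ->]. Qed.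

Section BiopCoefficients.
Variables (R : realType) (k : 'I_3 -> R).
Local Notation C := (R[i]).
Local Notation P := {mpoly C[3]}.
Local Notation V := (V R).
Implicit Types (v w : V) (f : P) (m : 'X_{1..3}).

Lemma mcoeff_angop p q f m : p != q -> (angop k p q f)@_m =
  (if (0 < m q)%N then lam k p (m p).+1 * f@_(m - U_(q) + U_(p)) else 0)
  - (if (0 < m p)%N then lam k q (m q).+1 * f@_(m - U_(p) + U_(q)) else 0).
Proof.
move=> npq; rewrite /angop mcoeffB; congr (_ - _); rewrite mcoeffXM mcoeff_dunkl.
  by rewrite mnmBE mnm1E [q == p]eq_sym (negPf npq) subn0.
by rewrite mnmBE mnm1E (negPf npq) subn0.
Qed.

(** [angop] transfers one unit of exponent between [x_p] and [x_q]; the parity of the sum of these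
    exponents is preserved, so the reflections pull out as a sign. *)
Lemma mcoeff_angop_sign p q f g m : p != q ->
  (forall m', g@_m' = (-1) ^+ (m' p + m' q) * f@_m') ->
  (angop k p q g)@_m = (-1) ^+ (m p + m q) * (angop k p q f)@_m.
Proof.
move=> npq gE; rewrite [LHS]mcoeff_angop // !gE [X in _ = _ * X]mcoeff_angop //.
rewrite !mnmDE !mnmBE !mnm1E !eqxx [q == p]eq_sym (negPf npq) !subn0 !addn0 mulrBr.
move: (m p) (m q) (f@_ _) (f@_ _) => x y c c'.
by case: x => [|x]; case: y => [|y] /=;
  rewrite ?subn1 ?addn1 ?add0n ?addn0 /= ?addSn ?addnS ?addn0 ?exprS; ring.
Qed.

Lemma mcoeff_refl2 p q f m : (refl p (refl q f))@_m = (-1) ^+ (m p + m q) * f@_m.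
Proof.
by apply: etrans (mcoeff_refl _ _ _) _; rewrite exprD -mulrA; congr (_ * _); exact: mcoeff_refl.
Qed.

Lemma mcoeff_angop_refl p q f m : p != q ->
  (angop k p q (refl p (refl q f)))@_m = (-1) ^+ (m p + m q) * (angop k p q f)@_m.
Proof. by move=> npq; apply: mcoeff_angop_sign => // m'; exact: mcoeff_refl2. Qed.

Lemma mcoeff_comb (x y : C) (g h fq fp : P) (a b c d : C) m :
  g@_m = a -> h@_m = b -> fq@_m = c -> fp@_m = d ->
  ('i *: g + 2^-1 *: h + x *: fq + y *: fp)@_m = 'i * a + 2^-1 * b + x * c + y * d.
Proof. by move=> <- <- <- <-; rewrite !mcoeffD !mcoeffZ. Qed.

Lemma mcoeff_biop1 a p q w m : p != q -> (biop k a p q w).1@_m =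
  (-1) ^+ (m p + m q) * ('i * (match val a with
     | 0 => (angop k p q w.2)@_m
     | 1 => - 'i * (angop k p q w.2)@_m
     | _ => (angop k p q w.1)@_m end) + 2^-1 * w.1@_m)
  + rc (k p) * ((-1) ^+ m q * w.1@_m) + rc (k q) * ((-1) ^+ m p * w.1@_m).
Proof.
move=> npq; rewrite mulrDr [_ * ('i * _)]mulrCA [_ * (2^-1 * _)]mulrCA.
apply: mcoeff_comb; [|exact: mcoeff_refl2|exact: mcoeff_refl|exact: mcoeff_refl].
rewrite /cliff /pauli; case: (val a) => [|[|x]] /=.
- exact: mcoeff_angop_refl.
- by rewrite mcoeffZ mulrCA; congr (_ * _); exact: mcoeff_angop_refl.
- exact: mcoeff_angop_refl.
Qed.

Lemma mcoeff_biop2 a p q w m : p != q -> (biop k a p q w).2@_m =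
  (-1) ^+ (m p + m q) * ('i * (match val a with
     | 0 => (angop k p q w.1)@_m
     | 1 => 'i * (angop k p q w.1)@_m
     | _ => - (angop k p q w.2)@_m end) + 2^-1 * w.2@_m)
  + rc (k p) * ((-1) ^+ m q * w.2@_m) + rc (k q) * ((-1) ^+ m p * w.2@_m).
Proof.
move=> npq; rewrite mulrDr [_ * ('i * _)]mulrCA [_ * (2^-1 * _)]mulrCA.
apply: mcoeff_comb; [|exact: mcoeff_refl2|exact: mcoeff_refl|exact: mcoeff_refl].
rewrite /cliff /pauli; case: (val a) => [|[|x]] /=.
- exact: mcoeff_angop_refl.
- by rewrite mcoeffZ mulrCA; congr (_ * _); exact: mcoeff_angop_refl.
- by rewrite mcoeffN mulrN; congr (- _); exact: mcoeff_angop_refl.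
Qed.

Lemma sum3 (T : nmodType) (f : 'I_3 -> T) : \sum_(i < 3) f i = f 0 + f 1 + f 2.
Proof.
rewrite !big_ord_recl big_ord0 addr0 addrA.
by congr (f _ + f _ + f _); apply: val_inj.
Qed.

Lemma mcoeff_add3 (f g h : P) (a b c : C) m :
  f@_m = a -> g@_m = b -> h@_m = c -> (f + g + h)@_m = a + b + c.
Proof. by move=> <- <- <-; rewrite !mcoeffD. Qed.

Lemma mcoeff_dirac1 w m : (dirac k w).1@_m =
  lam k 0 (m 0).+1 * w.2@_(m + U_(0)) + - 'i * (lam k 1 (m 1).+1 * w.2@_(m + U_(1)))
  + lam k 2 (m 2).+1 * w.1@_(m + U_(2)).
Proof.
rewrite /dirac sum3; apply: mcoeff_add3; [exact: mcoeff_dunkl| |exact: mcoeff_dunkl].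
by rewrite /cliff /pauli /= mcoeffZ; congr (_ * _); exact: mcoeff_dunkl.
Qed.

Lemma mcoeff_dirac2 w m : (dirac k w).2@_m =
  lam k 0 (m 0).+1 * w.1@_(m + U_(0)) + 'i * (lam k 1 (m 1).+1 * w.1@_(m + U_(1)))
  + - (lam k 2 (m 2).+1 * w.2@_(m + U_(2))).
Proof.
rewrite /dirac sum3; apply: mcoeff_add3; [exact: mcoeff_dunkl| |].
  by rewrite /cliff /pauli /= mcoeffZ; congr (_ * _); exact: mcoeff_dunkl.
by rewrite /cliff /pauli /= mcoeffN; congr (- _); exact: mcoeff_dunkl.
Qed.
End BiopCoefficients.

(** The flag says that the exponent to be lowered is positive; it keeps truncated predecessors from
    producing spurious neighbours. *)
Definition hop (R : realType) (b : bool) (x y : R[i]) : R[i] := if b then x * y else 0.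

(* Plain [generalize] misses occurrences that differ in a universe level. *)
Ltac gen_coef := repeat match goal with
  | |- context [ @mcoeff ?n ?S ?m ?f ] =>
      let x := fresh "x" in pose (x := @mcoeff n S m f);
      repeat match goal with
        | |- context G [ @mcoeff n _ m f ] => let g := context G [ x ] in change g
      end; clearbody x
  | |- context [ lam ?k ?i ?j ] =>
      let x := fresh "l" in generalize (lam k i j); intro x
  end.

Section BiopValues.
Variables (R : realType) (k : 'I_3 -> R).
Local Notation C := (R[i]).
Local Notation V := (V R).

Lemma angop_hop (p q : 'I_3) (f : {mpoly C[3]}) (m m1 m2 : 'X_{1..3}) b c :
  p != q -> m p = b -> m q = c ->
  ((0 < c)%N -> (m - U_(q) + U_(p))%MM = m1) ->
  ((0 < b)%N -> (m - U_(p) + U_(q))%MM = m2) ->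
  (angop k p q f)@_m =
  hop (0 < c)%N (lam k p b.+1) f@_m1 - hop (0 < b)%N (lam k q c.+1) f@_m2.
Proof.
move=> npq <- <- m1E m2E; apply: etrans (mcoeff_angop k f m npq) _; rewrite /hop.
apply: (congr2 (fun x y : C => x - y)).
  by case: ifP => [b0|_]; [case: _ / (m1E b0)|].
by case: ifP => [b0|_]; [case: _ / (m2E b0)|].
Qed.

(** The eigenvalue of [R_p R_q / 2 + k_p R_q + k_q R_p], the part of [biop] without derivatives, on
    a monomial with exponents [b] of [x_p] and [c] of [x_q]. *)
Definition bisign (p q : 'I_3) (b c : nat) : C :=
  (-1) ^+ (b + c) / 2 + rc (k p) * (-1) ^+ c + rc (k q) * (-1) ^+ b.

Lemma biop_values a p q (w : V) (m : 'X_{1..3}) b c g1 g2 :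
  p != q -> m p = b -> m q = c ->
  (angop k p q w.1)@_m = g1 -> (angop k p q w.2)@_m = g2 ->
  ((biop k a p q w).1@_m, (biop k a p q w).2@_m) =
  ((-1) ^+ (b + c) * 'i * (match val a with 0 => g2 | 1 => - 'i * g2 | _ => g1 end)
     + bisign p q b c * w.1@_m,
   (-1) ^+ (b + c) * 'i * (match val a with 0 => g1 | 1 => 'i * g1 | _ => - g2 end)
     + bisign p q b c * w.2@_m).
Proof.
move=> npq <- <- <- <-; rewrite /bisign; congr (_, _).
  by apply: etrans (mcoeff_biop1 k a w m npq) _; gen_coef; case: (val a) => [|[|?]]; ring.
by apply: etrans (mcoeff_biop2 k a w m npq) _; gen_coef; case: (val a) => [|[|?]]; ring.
Qed.
End BiopValues.

Section SpinCoordinates.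
Variables (R : realType) (k : 'I_3 -> R) (q1 q2 p : 'I_3).
Hypothesis cycq : cyc q1 q2 p.
Local Notation C := (R[i]).
Local Notation V := (V R).
Implicit Types (v w : V).

Local Opaque angop dunkl refl mpolyX.
Definition sp w a b c : C * C :=
  spin p (w.1@_(mon q1 q2 p a b c), w.2@_(mon q1 q2 p a b c)).

Lemma sp_dirac w a b c : sp (dirac k w) a b c =
  (lam k q1 a.+1 * (sp w a.+1 b c).2 - 'i * lam k q2 b.+1 * (sp w a b.+1 c).2
     + lam k p c.+1 * (sp w a b c.+1).1,
   lam k q1 a.+1 * (sp w a.+1 b c).1 + 'i * lam k q2 b.+1 * (sp w a b.+1 c).1
     - lam k p c.+1 * (sp w a b c.+1).2).
Proof.
have h := ii R; rewrite /sp mcoeff_dirac1 mcoeff_dirac2.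
case: cycq => -[-> -> ->];
  rewrite !(monU1, monU2, monU3) ?mon1 ?mon2 ?mon3 // /spin /=.
all: gen_coef; by congr (_, _); ring: h.
Qed.

Lemma sp_biop1 w a b c : sp (biop k q1 q2 p w) a b c =
  let D f := hop (0 < c)%N (lam k q2 b.+1) (f (sp w a b.+1 c.-1))
           - hop (0 < b)%N (lam k p c.+1) (f (sp w a b.-1 c.+1)) in
  ((-1) ^+ (b + c) * 'i * D snd + bisign k q2 p b c * (sp w a b c).1,
   (-1) ^+ (b + c) * 'i * D fst + bisign k q2 p b c * (sp w a b c).2).
Proof.
have h := ii R; have [n12 n1p n2p] := cyc_neq cycq.
have m2 := mon2 n12 n1p n2p a b c; have m3 := mon3 n12 n1p n2p a b c.
have ang f : (angop k q2 p f)@_(mon q1 q2 p a b c) =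
    hop (0 < c)%N (lam k q2 b.+1) f@_(mon q1 q2 p a b.+1 c.-1)
    - hop (0 < b)%N (lam k p c.+1) f@_(mon q1 q2 p a b.-1 c.+1).
  by apply: angop_hop => // ?; rewrite ?monB2 ?monB3 // ?monU2 ?monU3.
rewrite /sp (biop_values q1 n2p m2 m3 (ang w.1) (ang w.2)) {ang m2 m3} /hop.
move: (bisign _ _ _ _ _) ((-1) ^+ _) => e s; case: w => w1 w2 /=; gen_coef.
case: ifP => _; case: ifP => _; case: cycq => -[-> _ ->];
  rewrite /spin /=.
all: by congr (_, _); field: h.
Qed.

Lemma sp_biop2 w a b c : sp (biop k q2 p q1 w) a b c =
  let D f := hop (0 < a)%N (lam k p c.+1) (f (sp w a.-1 b c.+1))
           - hop (0 < c)%N (lam k q1 a.+1) (f (sp w a.+1 b c.-1)) in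
  ((-1) ^+ (c + a) * D snd + bisign k p q1 c a * (sp w a b c).1,
   - (-1) ^+ (c + a) * D fst + bisign k p q1 c a * (sp w a b c).2).
Proof.
have h := ii R; have [n12 n1p n2p] := cyc_neq cycq.
have m1 := mon1 n12 n1p n2p a b c; have m3 := mon3 n12 n1p n2p a b c.
have np1 : p != q1 by rewrite eq_sym.
have ang f : (angop k p q1 f)@_(mon q1 q2 p a b c) =
    hop (0 < a)%N (lam k p c.+1) f@_(mon q1 q2 p a.-1 b c.+1)
    - hop (0 < c)%N (lam k q1 a.+1) f@_(mon q1 q2 p a.+1 b c.-1).
  by apply: angop_hop => // ?; rewrite ?monB1 ?monB3 // ?monU1 ?monU3.
rewrite /sp (biop_values q2 np1 m3 m1 (ang w.1) (ang w.2)) {ang m1 m3} /hop.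
move: (bisign _ _ _ _ _) ((-1) ^+ _) => e s; case: w => w1 w2 /=; gen_coef.
case: ifP => _; case: ifP => _; case: cycq => -[_ -> ->];
  rewrite /spin /=.
all: by congr (_, _); field: h.
Qed.

Lemma sp_biop3 w a b c : sp (biop k p q1 q2 w) a b c =
  let D f := hop (0 < b)%N (lam k q1 a.+1) (f (sp w a.+1 b.-1 c))
           - hop (0 < a)%N (lam k q2 b.+1) (f (sp w a.-1 b.+1 c)) in
  ((-1) ^+ (a + b) * 'i * D fst + bisign k q1 q2 a b * (sp w a b c).1,
   - (-1) ^+ (a + b) * 'i * D snd + bisign k q1 q2 a b * (sp w a b c).2).
Proof.
have h := ii R; have [n12 n1p n2p] := cyc_neq cycq.
have m1 := mon1 n12 n1p n2p a b c; have m2 := mon2 n12 n1p n2p a b c.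
have ang f : (angop k q1 q2 f)@_(mon q1 q2 p a b c) =
    hop (0 < b)%N (lam k q1 a.+1) f@_(mon q1 q2 p a.+1 b.-1 c)
    - hop (0 < a)%N (lam k q2 b.+1) f@_(mon q1 q2 p a.-1 b.+1 c).
  by apply: angop_hop => // ?; rewrite ?monB1 ?monB2 // ?monU1 ?monU2.
rewrite /sp (biop_values p n12 m1 m2 (ang w.1) (ang w.2)) {ang m1 m2} /hop.
move: (bisign _ _ _ _ _) ((-1) ^+ _) => e s; case: w => w1 w2 /=; gen_coef.
case: ifP => _; case: ifP => _; case: cycq => -[_ _ ->];
  rewrite /spin /=.
all: by congr (_, _); field: h.
Qed.
End SpinCoordinates.

Section Coordinates.
Variables (R : realType) (k : 'I_3 -> R) (q1 q2 p : 'I_3).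
Hypothesis cycq : cyc q1 q2 p.
Local Notation C := (R[i]).
Local Notation V := (V R).
Implicit Types (v w : V).
Local Notation F := (sp q1 q2 p).

Lemma spin_eq0 (s : C * C) : spin p s = (0, 0) -> s = (0, 0).
Proof.
by move=> s0; rewrite -[s](spinK p) s0 /unspin; case: (val p) => [|[|r]] //=;
  rewrite !(mulr0, subr0, addr0, mul0r).
Qed.

Lemma sp_eq0 w a b c : F w a b c = (0, 0) <->
  w.1@_(mon q1 q2 p a b c) = 0 /\ w.2@_(mon q1 q2 p a b c) = 0.
Proof.
rewrite /sp; split=> [/spin_eq0[-> ->] //|[-> ->]].
by rewrite /spin; case: (val p) => [|[|r]] //=; rewrite ?mulr0 ?subr0 ?addr0 ?mulr0.
Qed.

Lemma sp_coef0 w : (forall a b c, F w a b c = (0, 0)) <-> w = 0.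
Proof.
have [n12 n1p n2p] := cyc_neq cycq.
split=> [w0|-> a b c]; last by apply/sp_eq0; rewrite !mcoeff0.
case: w w0 => w1 w2 w0; suff [-> ->] : w1 = 0 /\ w2 = 0 by [].
split; apply/mpolyP => m; rewrite mcoeff0 (monE n12 n1p n2p m).
  by have /sp_eq0[] := w0 (m q1) (m q2) (m p).
by have /sp_eq0[] := w0 (m q1) (m q2) (m p).
Qed.

Lemma homogVP n w : homogV n w <->
  forall a b c, (a + b + c)%N != n -> F w a b c = (0, 0).
Proof.
have [n12 n1p n2p] := cyc_neq cycq; split=> [[h1 h2] a b c nabc|h].
  have md : mdeg (mon q1 q2 p a b c) != n by rewrite mdeg_mon.
  apply/sp_eq0; split; [exact: dhomog_nemf_coeff h1 md|exact: dhomog_nemf_coeff h2 md].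
have h0 m : mdeg m != n -> w.1@_m = 0 /\ w.2@_m = 0.
  by rewrite [m](monE n12 n1p n2p m) mdeg_mon => /h/sp_eq0.
split; apply/dhomogP => m; rewrite mcoeff_msupp => wm; apply/eqP; apply: contraNT wm.
  by move=> /h0[-> _].
by move=> /h0[_ ->].
Qed.

Lemma MnP n w : Mn k n w <-> (forall a b c, (a + b + c)%N != n -> F w a b c = (0, 0))
  /\ (forall a b c, F (dirac k w) a b c = (0, 0)).
Proof.
split=> [[/homogVP hw Dw]|[hw Dw]]; split=> //; first exact/sp_coef0.
  exact/homogVP.
exact/sp_coef0.
Qed.
End Coordinates.

(** * Support and uniqueness of monogenics *)

Section Threshold.
Variables (R : realType) (k : 'I_3 -> R).
Local Notation C := (R[i]).

Lemma tparP i t : tpar (k i) = Some t -> odd t /\ rc (k i) = - (t%:R / 2).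
Proof.
rewrite /tpar; case: ifP => // /andP[/natrP[m xE] om] [tE].
rewrite xE Num.Theory.natrK in om tE; rewrite -tE om; split=> //.
have kE : k i = - (m%:R / 2) by rewrite -xE; field.
rewrite kE -[rc _]/((- (m%:R / 2))%:C)%C rmorphN rmorphM fmorphV /= !rmorph_nat.
by [].
Qed.

Lemma lamE i t j : tpar (k i) = Some t ->
  lam k i j = if odd j then j%:R - t%:R else j%:R.
Proof.
move=> /tparP[_ kE]; rewrite /lam kE; case: (odd j); last by rewrite addr0.
by field.
Qed.

Lemma lam_tpar i t : tpar (k i) = Some t -> lam k i t = 0.
Proof. by move=> /[dup] /tparP[ot _] /lamE ->; rewrite ot subrr. Qed.

Lemma lam_neq0 i t j : tpar (k i) = Some t -> (0 < j)%N -> j != t -> lam k i j != 0.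
Proof.
move=> /lamE -> j0 jt; case: ifP => _; last by rewrite pnatr_eq0 -lt0n.
by rewrite subr_eq0 eqr_nat.
Qed.
End Threshold.

Section Monogenic.
Variables (R : realType) (k : 'I_3 -> R) (q1 q2 p : 'I_3) (n : nat).
Hypothesis cycq : cyc q1 q2 p.
Local Notation C := (R[i]).
Local Notation V := (V R).
Implicit Types (v w : V).
Local Notation F := (sp q1 q2 p).
Local Opaque sp.

Lemma Mn_degree w a b c : Mn k n w -> (a + b + c)%N != n -> F w a b c = (0, 0).
Proof. by move=> /(MnP k cycq)[hw _]; exact: hw. Qed.

Lemma Mn_dirac1 w a b c : Mn k n w ->
  lam k q1 a.+1 * (F w a.+1 b c).2 - 'i * lam k q2 b.+1 * (F w a b.+1 c).2
     + lam k p c.+1 * (F w a b c.+1).1 = 0.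
Proof. by move=> /(MnP k cycq)[_ /(_ a b c)]; rewrite sp_dirac // => -[]. Qed.

Lemma Mn_dirac2 w a b c : Mn k n w ->
  lam k q1 a.+1 * (F w a.+1 b c).1 + 'i * lam k q2 b.+1 * (F w a b.+1 c).1
     - lam k p c.+1 * (F w a b c.+1).2 = 0.
Proof. by move=> /(MnP k cycq)[_ /(_ a b c)]; rewrite sp_dirac // => -[]. Qed.

Lemma lincomb3 (x y z c1 c2 c3 r : C) :
  x = 0 -> y = 0 -> z = 0 -> r = c1 * x + c2 * y + c3 * z -> r = 0.
Proof. by move=> -> -> -> ->; rewrite !mulr0 !addr0. Qed.

(** [biop] commutes with the Dirac operator: the multipliers [x], [y], [s] below are the
    coefficients of [biop] itself, so the combination of Dirac equations of [w] is a coefficient of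
    [biop] applied to [dirac k w]. *)
Lemma Mn_biop w : Mn k n w -> Mn k n (biop k q1 q2 p w).
Proof.
move=> Mw; have h := ii R; apply/(MnP k cycq); split=> [a b c nabc|a b c].
  rewrite sp_biop1 // /hop (Mn_degree Mw nabc).
  case: posnP => c0; case: posnP => b0;
    rewrite /= ?[F w a b.+1 c.-1](Mn_degree Mw) ?[F w a b.-1 c.+1](Mn_degree Mw) /=
      ?mulr0 ?subr0 ?mulr0 ?addr0 ?mulr0 //; by apply: contra nabc => /eqP <-; apply/eqP; lia.
have D1 := Mn_dirac1 a b c Mw; have D2 := Mn_dirac2 a b c Mw.
have E1 := Mn_dirac1 a b.+1 c.-1 Mw; have E2 := Mn_dirac2 a b.+1 c.-1 Mw.
have G1 := Mn_dirac1 a b.-1 c.+1 Mw; have G2 := Mn_dirac2 a b.-1 c.+1 Mw.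
rewrite sp_dirac // !sp_biop1 // /hop /bisign.
move: (F w) E1 E2 G1 G2 D1 D2 => f.
pose e : C := (-1) ^+ (b + c).
pose s := e / 2 + rc (k q2) * (-1) ^+ c + rc (k p) * (-1) ^+ b.
pose x := (0 < c)%:R * e * 'i * lam k q2 b.+1; pose y := - ((0 < b)%:R * e * 'i * lam k p c.+1).
move=> E1 E2 G1 G2 D1 D2; congr (_, _).
  apply: (lincomb3 (c1 := x) (c2 := y) (c3 := s) E2 G2 D1); rewrite {}/x {}/y {}/s {}/e.
  case: b c {E1 E2 G1 G2 D1 D2} => [|b] [|c] /=; rewrite /lam !sign_parity /= ?oddD /=;
    try (case: (odd b) => /=); try (case: (odd c) => /=); rewrite -?natr1; by field: h.
apply: (lincomb3 (c1 := x) (c2 := y) (c3 := s) E1 G1 D2); rewrite {}/x {}/y {}/s {}/e.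
case: b c {E1 E2 G1 G2 D1 D2} => [|b] [|c] /=; rewrite /lam !sign_parity /= ?oddD /=;
  try (case: (odd b) => /=); try (case: (odd c) => /=); rewrite -?natr1; by field: h.
Qed.
End Monogenic.

Section Support.
Variables (R : realType) (k : 'I_3 -> R) (q1 q2 p : 'I_3) (n t1 t2 t3 : nat).
Hypothesis cycq : cyc q1 q2 p.
Hypotheses (tp1 : tpar (k q1) = Some t1) (tp2 : tpar (k q2) = Some t2)
  (tp3 : tpar (k p) = Some t3).
Local Notation C := (R[i]).
Local Notation V := (V R).
Implicit Types (v w : V) (G : nat -> nat -> Prop).
Local Notation F := (sp q1 q2 p).
Local Notation comp e s := (if e then snd s else fst s).
Local Opaque sp.

(** The Dirac equation at [(a, b, c)] solved for its term in [x_p]; [t3] is the only positive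
    exponent at which this is impossible. *)
Lemma Mn_step w a b c : Mn k n w ->
  lam k q1 a.+1 = 0 \/ F w a.+1 b c = (0, 0) ->
  lam k q2 b.+1 = 0 \/ F w a b.+1 c = (0, 0) ->
  c.+1 != t3 -> F w a b c.+1 = (0, 0).
Proof.
move=> Mw hA hB hc; have nz : lam k p c.+1 != 0 by apply: lam_neq0 tp3 _ hc.
have D1 := Mn_dirac1 cycq a b c Mw; have D2 := Mn_dirac2 cycq a b c Mw.
have A0 f : f = @fst C C \/ f = snd -> lam k q1 a.+1 * f (F w a.+1 b c) = 0.
  by case: hA => ->; [rewrite mul0r|case=> ->; rewrite mulr0].
have B0 f : f = @fst C C \/ f = snd -> lam k q2 b.+1 * f (F w a b.+1 c) = 0.
  by case: hB => ->; [rewrite mul0r|case=> ->; rewrite mulr0].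
move: D1 D2; rewrite -!mulrA !A0 ?B0; [|by auto..].
rewrite !mulr0 subr0 !add0r => /eqP D1 /eqP D2.
move: D1 D2; rewrite oppr_eq0 !mulf_eq0 (negPf nz) /=.
by case: (F w a b c.+1) => x y /= /eqP-> /eqP->.
Qed.

(** Two small exponents force the third above [t3], by the bound on [n], so [Mn_step] applies. It
    moves towards the corner [(t1, t2)], and the terms that would leave the rectangle carry [lam] at
    a threshold, which is 0. *)
Lemma Mn_vanish w a b c : (t1 + t2 + t3 <= n)%N -> Mn k n w ->
  (a < t1)%N -> (b < t2)%N -> F w a b c = (0, 0).
Proof.
move=> tn Mw; have [N] := ubnP ((t1 - a) + (t2 - b))%N.
elim: N a b c => // N IH a b c ltN a1 b2.
have [abc|] := eqVneq (a + b + c)%N n; last exact: Mn_degree Mw.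
case: c abc => [|c] abc; first by lia.
apply: Mn_step => //; last by lia.
  have [->|ne] := eqVneq a.+1 t1; first by left; apply: lam_tpar.
  by right; apply: IH; lia.
have [->|ne] := eqVneq b.+1 t2; first by left; apply: lam_tpar.
by right; apply: IH; lia.
Qed.

(** Regions on which the recursion in the exponent of [x_p] is autonomous: a neighbour outside the
    region enters only with coefficient 0. The instances are [a < t1], [b < t2] and the whole
    plane. *)
Definition lam_closed G := forall a b, G a b ->
  (lam k q1 a.+1 = 0 \/ G a.+1 b) /\ (lam k q2 b.+1 = 0 \/ G a b.+1).

Lemma Mn_unique G w : lam_closed G -> Mn k n w ->
  (forall a b c, G a b -> (c <= t3)%N -> F w a b c = (0, 0)) ->
  forall a b c, G a b -> F w a b c = (0, 0).
Proof.
move=> clG Mw w0 a b c; elim: c a b => [|c IH] a b Gab; first exact: w0.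
have [lec|ltc] := leqP c.+1 t3; first exact: w0.
have [hA hB] := clG _ _ Gab.
apply: Mn_step => //; last by rewrite gtn_eqF.
  by case: hA => [|/IH]; [left|right].
by case: hB => [|/IH]; [left|right].
Qed.

(** The Dirac equation solved for the coefficient with one more factor [x_p], starting from
    data [h] on the monomials with exponent [t3] of [x_p]. *)
Fixpoint ck (h : nat -> nat -> C * C) (j a b : nat) : C * C :=
  if j is j'.+1 then
    let x := ck h j' a.+1 b in let y := ck h j' a b.+1 in
    ((- lam k q1 a.+1 * x.2 + 'i * lam k q2 b.+1 * y.2) / lam k p (t3 + j),
     (lam k q1 a.+1 * x.1 + 'i * lam k q2 b.+1 * y.1) / lam k p (t3 + j))
  else h a b.

(** The recursion lowers the exponent of [x_q1] one unit at a time, and the step from [t1] to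
    [t1 - 1] has the factor [lam k q1 t1 = 0]: the support never crosses the threshold. *)
Lemma ck_supp1 h : (forall a b, (a < t1)%N -> h a b = (0, 0)) ->
  forall j a b, (a < t1)%N -> ck h j a b = (0, 0).
Proof.
move=> h0; elim=> [|j IH] a b a1 /=; first exact: h0.
rewrite (IH a b.+1) //=; have [->|ne] := eqVneq a.+1 t1.
  by rewrite (lam_tpar tp1) oppr0 !mul0r mulr0 addr0 mul0r.
by rewrite (IH a.+1 b) /= ?mulr0 ?addr0 ?mul0r //; lia.
Qed.

Lemma ck_supp2 h : (forall a b, (b < t2)%N -> h a b = (0, 0)) ->
  forall j a b, (b < t2)%N -> ck h j a b = (0, 0).
Proof.
move=> h0; elim=> [|j IH] a b b2 /=; first exact: h0.
rewrite (IH a.+1 b) //=; have [->|ne] := eqVneq b.+1 t2.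
  by rewrite (lam_tpar tp2) !mulr0 !mul0r addr0 mul0r.
by rewrite (IH a b.+1) /= ?mulr0 ?addr0 ?mul0r //; lia.
Qed.

Definition ck_coef h (m : 'X_{1..3}) : C * C :=
  if (mdeg m == n) && (t3 <= m p)%N then unspin p (ck h (m p - t3) (m q1) (m q2))
  else (0, 0).

Definition ck_ext h : V :=
  (\sum_(m : 'X_{1..3 < n.+1}) (ck_coef h m).1 *: 'X_[m],
   \sum_(m : 'X_{1..3 < n.+1}) (ck_coef h m).2 *: 'X_[m]).

Lemma mcoeff_bounded_sum (f : 'X_{1..3} -> C) (m : 'X_{1..3}) :
  (mdeg m != n -> f m = 0) -> (\sum_(m : 'X_{1..3 < n.+1}) f m *: 'X_[m])@_m = f m.
Proof.
move=> fm; have [lem|ltm] := ltnP (mdeg m) n.+1; first exact: mcoeff_mpoly.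
rewrite fm ?gtn_eqF // raddf_sum big1 // => m' _ /=; rewrite mcoeffZ mcoeffX.
case: eqP => [m'm|_]; last by rewrite mulr0.
by have := bmdeg m'; rewrite m'm ltnNge ltm.
Qed.

Lemma sp_ck_ext h a b c : F (ck_ext h) a b c =
  if ((a + b + c)%N == n) && (t3 <= c)%N then ck h (c - t3) a b else (0, 0).
Proof.
have [n12 n1p n2p] := cyc_neq cycq.
have m1 := mon1 n12 n1p n2p a b c; have m2 := mon2 n12 n1p n2p a b c.
have m3 := mon3 n12 n1p n2p a b c; have md := mdeg_mon q1 q2 p a b c.
Local Transparent sp.
rewrite /sp; set m := mon q1 q2 p a b c in m1 m2 m3 md *.
have ckE : ck_coef h m = if ((a + b + c)%N == n) && (t3 <= c)%N
    then unspin p (ck h (c - t3) a b) else (0, 0).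
  by rewrite /ck_coef m1 m2 m3 md.
have ck0 : mdeg m != n -> ck_coef h m = (0, 0).
  by rewrite md ckE => /negPf ->.
have -> : (ck_ext h).1@_m = (ck_coef h m).1.
  by apply: (@mcoeff_bounded_sum (fun m => (ck_coef h m).1)) => /ck0 ->.
have -> : (ck_ext h).2@_m = (ck_coef h m).2.
  by apply: (@mcoeff_bounded_sum (fun m => (ck_coef h m).2)) => /ck0 ->.
rewrite -surjective_pairing ckE; case: ifP => _; first exact: unspinK.
by rewrite /spin; case: (val p) => [|[|r]] //=; rewrite ?mulr0 ?subr0 ?addr0 ?mulr0.
Qed.
Local Opaque sp.

Lemma Mn_ck_ext h : Mn k n (ck_ext h).
Proof.
have ih := ii R; apply/(MnP k cycq); split=> [a b c nabc|a b c].
  by rewrite sp_ck_ext (negPf nabc).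
rewrite sp_dirac // !sp_ck_ext.
rewrite (_ : (a.+1 + b + c)%N = (a + b + c).+1); last by lia.
rewrite (_ : (a + b.+1 + c)%N = (a + b + c).+1); last by lia.
rewrite (_ : (a + b + c.+1)%N = (a + b + c).+1); last by lia.
case: eqVneq => abc /=; last by rewrite !mulr0 !subr0 !addr0.
have [ltc|lec] := ltnP c t3.
  (* The layer just below the data would constrain [h], were it not multiplied by [lam k p t3 = 0];
     this is why [h] is arbitrary. *)
  have [ct|nct] := eqVneq c.+1 t3.
    by rewrite ct leqnn (lam_tpar tp3) !mul0r !mulr0 !subr0 !addr0.
  by rewrite (_ : (t3 <= c.+1)%N = false) ?mulr0 ?subr0 ?addr0 //; lia.
rewrite (leqW lec) subSn //= -subSn // subnKC ?leqW //.
have nz : lam k p c.+1 != 0 by apply: lam_neq0 tp3 _ _ => //; lia.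
by congr (_, _); field.
Qed.
End Support.

(** * Lines of monomials *)

Section LineAction.
Variables (R : realType) (k : 'I_3 -> R) (q1 q2 p : 'I_3) (n t1 t2 t3 : nat).
Hypotheses (tp1 : tpar (k q1) = Some t1) (tp2 : tpar (k q2) = Some t2)
  (tp3 : tpar (k p) = Some t3) (n_odd : odd n).
Local Notation C := (R[i]).

(* The spinor coordinates and the three operators are kept abstract: comparing
   the concrete polynomial expressions up to conversion is far too slow. *)
Variables (V : Type) (M : V -> Prop) (F : V -> nat -> nat -> nat -> C * C) (P Q S : V -> V).
Implicit Types (v w : V).
Hypothesis F_P : forall w a b c, F (P w) a b c =
  let D f := hop (0 < c)%N (lam k q2 b.+1) (f (F w a b.+1 c.-1))
           - hop (0 < b)%N (lam k p c.+1) (f (F w a b.-1 c.+1)) in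
  ((-1) ^+ (b + c) * 'i * D snd + bisign k q2 p b c * (F w a b c).1,
   (-1) ^+ (b + c) * 'i * D fst + bisign k q2 p b c * (F w a b c).2).
Hypothesis F_Q : forall w a b c, F (Q w) a b c =
  let D f := hop (0 < a)%N (lam k p c.+1) (f (F w a.-1 b c.+1))
           - hop (0 < c)%N (lam k q1 a.+1) (f (F w a.+1 b c.-1)) in
  ((-1) ^+ (c + a) * D snd + bisign k p q1 c a * (F w a b c).1,
   - (-1) ^+ (c + a) * D fst + bisign k p q1 c a * (F w a b c).2).
Hypothesis F_S : forall w a b c, F (S w) a b c =
  let D f := hop (0 < b)%N (lam k q1 a.+1) (f (F w a.+1 b.-1 c))
           - hop (0 < a)%N (lam k q2 b.+1) (f (F w a.-1 b.+1 c)) in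
  ((-1) ^+ (a + b) * 'i * D fst + bisign k q1 q2 a b * (F w a b c).1,
   - (-1) ^+ (a + b) * 'i * D snd + bisign k q1 q2 a b * (F w a b c).2).
Hypothesis F_dirac1 : forall w a b c, M w ->
  lam k q1 a.+1 * (F w a.+1 b c).2 - 'i * lam k q2 b.+1 * (F w a b.+1 c).2
     + lam k p c.+1 * (F w a b c.+1).1 = 0.
Hypothesis F_dirac2 : forall w a b c, M w ->
  lam k q1 a.+1 * (F w a.+1 b c).1 + 'i * lam k q2 b.+1 * (F w a b.+1 c).1
     - lam k p c.+1 * (F w a b c.+1).2 = 0.

Definition comp (e : bool) (s : C * C) : C := if e then s.2 else s.1.
Definition lf e a b w : C := comp e (F w a b t3).

Definition ie (e : bool) : C := (-1) ^+ e * 'i.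

(** With [t = - 2 k_q] and [t3 = - 2 k_p] this is [- (-1)^b (b + 1/2 + k_q - k_p)], the diagonal of
    the operator that exchanges [x_q] and [x_p]. *)
Definition diag (t : nat) (b : nat) : C := - ((-1) ^+ b * (2 * b%:R + 1 - t%:R + t3%:R) / 2).
Definition hopP e a b : C := (-1) ^+ b * ie e * lam k q1 a.+1.
Definition hopQ e a b : C := - ((-1) ^+ a * ie e * lam k q2 b.+1).

Variable G : nat -> nat -> Prop.
Hypothesis clG : lam_closed k q1 q2 G.
Definition vanishing w := forall a b c, G a b -> (c < t3)%N -> F w a b c = (0, 0).

(** [P] leads off the line in both directions. The neighbour with exponent [t3 - 1] is 0 or has
    coefficient 0, and the one with exponent [t3 + 1] is brought back to the line by the Dirac
    equation. [P] and that equation both flip the spin component, so [e] is preserved. *)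
Lemma line_P e a b w : M w -> vanishing w -> G a b ->
  lf e a b (P w) =
    diag t2 b * lf e a b w + (if b is b'.+1 then hopP e a b * lf e a.+1 b' w else 0).
Proof.
move=> Mw vw Gab; have h := ii R.
have [o3 k3] := tparP tp3; have [o2 k2] := tparP tp2.
have [Z1 Z2] : hop (0 < t3)%N (lam k q2 b.+1) (F w a b.+1 t3.-1).1 = 0
    /\ hop (0 < t3)%N (lam k q2 b.+1) (F w a b.+1 t3.-1).2 = 0.
  rewrite /hop; case: ifP => // t30; have [_ [->|Gb]] := clG Gab.
    by rewrite !mul0r.
  by rewrite (vw _ _ _ Gb) ?ltn_predL //= mulr0.
rewrite /lf F_P /= Z1 Z2; rewrite /bisign k3 k2 /hop /diag /hopP /ie.
rewrite !exprD -(signr_odd _ t3) o3.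
case: b {Z1 Z2 Gab} => [|b] /=.
  by rewrite /comp; case: e => /=; rewrite ?expr0 ?expr1; field: h.
have D1 := F_dirac1 a b t3 Mw; have D2 := F_dirac2 a b t3 Mw.
have [D1' D2'] : lam k p t3.+1 * (F w a b t3.+1).1 =
    - (lam k q1 a.+1 * (F w a.+1 b t3).2 - 'i * lam k q2 b.+1 * (F w a b.+1 t3).2)
  /\ lam k p t3.+1 * (F w a b t3.+1).2 =
    lam k q1 a.+1 * (F w a.+1 b t3).1 + 'i * lam k q2 b.+1 * (F w a b.+1 t3).1.
  by split; [apply/eqP; rewrite -addr_eq0 addrC D1|apply/eqP; rewrite eq_sym -subr_eq0 D2].
rewrite D1' D2' (lamE b.+1 tp2) /= -!(signr_odd _ b.+1) -!natr1 /=.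
move: (F w a.+1 b t3) (F w a b.+1 t3) => [u1 u2] [v1 v2].
by rewrite /comp; case: e; case: (odd b) => /=; rewrite ?expr0 ?expr1; field: h.
Qed.

Lemma line_Q e a b w : M w -> vanishing w -> G a b ->
  lf e a b (Q w) =
    diag t1 a * lf e a b w + (if a is a'.+1 then hopQ e a b * lf e a' b.+1 w else 0).
Proof.
move=> Mw vw Gab; have h := ii R.
have [o3 k3] := tparP tp3; have [o1 k1] := tparP tp1.
have [Z1 Z2] : hop (0 < t3)%N (lam k q1 a.+1) (F w a.+1 b t3.-1).1 = 0
    /\ hop (0 < t3)%N (lam k q1 a.+1) (F w a.+1 b t3.-1).2 = 0.
  rewrite /hop; case: ifP => // t30; have [[->|Gb] _] := clG Gab.
    by rewrite !mul0r.
  by rewrite (vw _ _ _ Gb) ?ltn_predL //= mulr0.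
rewrite /lf F_Q /= Z1 Z2; rewrite /bisign k3 k1 /hop /diag /hopQ /ie.
rewrite !exprD -(signr_odd _ t3) o3.
case: a {Z1 Z2 Gab} => [|a] /=.
  by rewrite /comp; case: e => /=; rewrite ?expr0 ?expr1; field: h.
have D1 := F_dirac1 a b t3 Mw; have D2 := F_dirac2 a b t3 Mw.
have [D1' D2'] : lam k p t3.+1 * (F w a b t3.+1).1 =
    - (lam k q1 a.+1 * (F w a.+1 b t3).2 - 'i * lam k q2 b.+1 * (F w a b.+1 t3).2)
  /\ lam k p t3.+1 * (F w a b t3.+1).2 =
    lam k q1 a.+1 * (F w a.+1 b t3).1 + 'i * lam k q2 b.+1 * (F w a b.+1 t3).1.
  by split; [apply/eqP; rewrite -addr_eq0 addrC D1|apply/eqP; rewrite eq_sym -subr_eq0 D2].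
rewrite D1' D2' (lamE a.+1 tp1) /= -!(signr_odd _ a.+1) -!natr1 /=.
move: (F w a.+1 b t3) (F w a b.+1 t3) => [u1 u2] [v1 v2].
by rewrite /comp; case: e; case: (odd a) => /=; rewrite ?expr0 ?expr1; field: h.
Qed.

(** The scalar by which [{P, Q} - S] acts, namely [2 k_q1 k_q2 - 2 k_p (k_q1 + k_q2 + k_p + n +
    1)]. *)
Definition lkap : C := t1%:R * t2%:R / 2 + t3%:R * (n%:R + 1 - (t1%:R + t2%:R + t3%:R) / 2).

Hypothesis downG : forall a b, (G a.+1 b -> G a b) /\ (G a b.+1 -> G a b).

(** [S] already preserves the exponent of [x_p]. Composing the bidiagonal formulas for [P] and [Q]
    yields the same two neighbours and a multiple of the coefficient at [(a, b)]. *)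
Lemma line_S e a b w : M w -> M (P w) -> M (Q w) ->
  vanishing w -> vanishing (P w) -> vanishing (Q w) -> G a b -> (a + b + t3)%N = n ->
  lf e a b (S w) = lf e a b (P (Q w)) + lf e a b (Q (P w)) - lkap * lf e a b w.
Proof.
move=> Mw MP MQ vw vP vQ Gab abn; have h := ii R.
have [o3 k3] := tparP tp3; have [o1 k1] := tparP tp1; have [o2 k2] := tparP tp2.
have Pup b' : b = b'.+1 -> hopP e a b * lf e a.+1 b' (Q w) = hopP e a b *
    (diag t1 a.+1 * lf e a.+1 b' w + hopQ e a.+1 b' * lf e a b w).
  move=> bE; move: (clG Gab); rewrite bE => -[[l0|/(proj2 (downG _ _)) Ga] _].
    by rewrite /hopP l0 mulr0 !mul0r.
  by rewrite line_Q.
have Qup a' : a = a'.+1 -> hopQ e a b * lf e a' b.+1 (P w) = hopQ e a b *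
    (diag t2 b.+1 * lf e a' b.+1 w + hopP e a' b.+1 * lf e a b w).
  move=> aE; move: (clG Gab); rewrite aE => -[_ [l0|/(proj1 (downG _ _)) Ga]].
    by rewrite /hopQ l0 mulr0 oppr0 !mul0r.
  by rewrite line_P.
rewrite [lf e a b (P (Q w))]line_P // [lf e a b (Q (P w))]line_Q //.
rewrite [lf e a b (P w)]line_P // [lf e a b (Q w)]line_Q //.
rewrite {1}/lf F_S /=.
have -> : lkap = t1%:R * t2%:R / 2
    + t3%:R * (a%:R + b%:R + t3%:R + 1 - (t1%:R + t2%:R + t3%:R) / 2).
  by rewrite /lkap -abn !natrD.
(* Here the oddness of [n] enters: [a] and [b] have equal parity along the line, which fixes all the
   relative signs. *)
have ab : odd b = odd a.
  by move: n_odd; rewrite -abn !oddD o3; case: (odd a); case: (odd b).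
rewrite /bisign k1 k2 !exprD.
case: a b {Gab abn MP MQ vP vQ vw Mw} ab Pup Qup => [|a] [|b] /= ab.
- move=> _ _; rewrite /hop /= /lf /comp /diag; case: (F w 0 0 t3) => x y.
  by case: e => /=; rewrite !expr0; field.
- move=> -> // _; rewrite /hop /= /hopP /hopQ /lf /comp /diag /ie.
  rewrite (lamE 1 tp1) (lamE b.+1 tp2) /= -!natr1 !exprS -!(signr_odd _ b).
  rewrite !expr0; move: ab; case: (odd b) => //= _.
  case: (F w _ _ _) (F w _ _ _) => [x1 x2] [y1 y2].
  by case: e => /=; rewrite !(expr0, expr1); field: h.
- move=> _ -> //; rewrite /hop /= /hopP /hopQ /lf /comp /diag /ie.
  rewrite (lamE 1 tp2) (lamE a.+1 tp1) /= -!natr1 !exprS -!(signr_odd _ a).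
  rewrite !expr0; move: ab; case: (odd a) => //= _.
  case: (F w _ _ _) (F w _ _ _) => [x1 x2] [y1 y2].
  by case: e => /=; rewrite !(expr0, expr1); field: h.
- move=> -> // -> //; rewrite /hop /= /hopP /hopQ /lf /comp /diag /ie.
  rewrite (lamE b.+2 tp2) (lamE a.+2 tp1) (lamE b.+1 tp2) (lamE a.+1 tp1) /=.
  rewrite -!natr1 !exprS -!(signr_odd _ a) -!(signr_odd _ b).
  move: ab => /(congr1 negb); rewrite !negbK => ->; case: (odd a).
  all: case: (F w _ _ _) (F w _ _ _) (F w _ _ _) => [x1 x2] [y1 y2] [z1 z2].
  all: case: e => /=; rewrite !(expr0, expr1).
  all: by field: h.
Qed.
End LineAction.

(** * From bidiagonal functionals to module maps *)

Section Realization.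
Variables (F : numFieldType) (d : nat) (a b c : F) (V : lmodType F) (W : V -> Prop).
Variables (P Q S : V -> V) (kf : nat -> V -> F) (x y : nat -> F).
Hypothesis d_even : ~~ odd d.
Hypothesis WP : forall w, W w -> W (P w).
Hypothesis WQ : forall w, W w -> W (Q w).
Hypothesis kf_linear : forall j r v w, kf j (r *: v + w) = r * kf j v + kf j w.
Hypothesis kfP : forall w j, W w -> (j <= d)%N ->
  kf j (P w) = Otheta d a j * kf j w + (if (j < d)%N then x j * kf j.+1 w else 0).
Hypothesis kfQ : forall w j, W w -> (j <= d)%N ->
  kf j (Q w) = beta d b j * kf j w + (if j is i.+1 then y j * kf i w else 0).
Hypothesis kfS : forall w j, W w -> (j <= d)%N ->
  kf j (S w) = kf j (P (Q w)) + kf j (Q (P w)) - kap d a b c * kf j w.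
Hypothesis xy : forall j, (j < d)%N -> x j * y j.+1 = zeta d a b c j.+1.
Hypothesis x_neq0 : forall j, (j < d)%N -> x j != 0.

(** The diagonal change of basis that turns the superdiagonal [x] into 1; only the products
    [x j * y j.+1] survive it, and these are [zeta]. *)
Definition wt (j : nat) : F := \prod_(i < j) x i.

Lemma wt_neq0 j : (j <= d)%N -> wt j != 0.
Proof.
move=> led; rewrite /wt prodf_seq_neq0; apply/allP=> i _ /=.
by apply: x_neq0; apply: leq_trans led.
Qed.

Definition real w : 'cV[F]_d.+1 := \col_j (wt j * kf j w).

Lemma co_real w j : (j <= d)%N -> co (real w) j = wt j * kf j w.
Proof.
by move=> led; rewrite -[j]/(val (Ordinal (led : (j < d.+1)%N))) coE mxE.
Qed.

Lemma real_linear r v w : real (r *: v + w) = r *: real v + real w.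
Proof. by apply/matrixP=> i j; rewrite !mxE kf_linear; ring. Qed.

Lemma real_LX w : W w -> real (P w) = LX d a *m real w.
Proof.
move=> Ww; apply/coP=> j led; rewrite co_LX ![co _ j]co_real // kfP // mulrDr mulrCA.
congr (_ + _); case: ltnP => [ltd|led'].
  by rewrite co_real // /wt big_ord_recr /= mulrA.
by rewrite mulr0 co_out.
Qed.

Lemma real_LY w : W w -> real (Q w) = LY d a b c *m real w.
Proof.
move=> Ww; apply/coP=> j led; rewrite co_LY // !co_real // ?(leq_trans (leq_pred _)) //.
rewrite kfQ // mulrDr mulrCA; congr (_ + _).
case: j led => [|j] led /=; first by rewrite mulr0 zeta0 mul0r.
by rewrite -xy // /wt big_ord_recr /=; ring.
Qed.

Lemma real_LZ w : W w -> real (S w) = LZ d a b c *m real w.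
Proof.
move=> Ww; have PW := WP Ww; have QW := WQ Ww.
rewrite LZE -(real_LY Ww) -(real_LX Ww) -(real_LX QW) -(real_LY PW).
apply/matrixP=> i j; rewrite !mxE (kfS Ww (ltn_ord i)).
by rewrite !mulrDr mulrN [wt i * (_ * _)]mulrCA.
Qed.

Lemma real_eq0 w : (real w = 0 <-> forall j, (j <= d)%N -> kf j w = 0).
Proof.
split=> [w0 j led|w0]; last first.
  by apply/coP=> j led; rewrite co_real // w0 // mulr0 co0.
have := co_real w led; rewrite w0 co0 => /esym/eqP.
by rewrite mulf_eq0 (negPf (wt_neq0 led)) => /eqP.
Qed.

Lemma real_surj (u : 'cV_d.+1) w :
  (forall j, (j <= d)%N -> kf j w = (wt j)^-1 * co u j) -> real w = u.
Proof.
by move=> hw; apply/coP=> j led; rewrite co_real // hw // mulVKf // wt_neq0.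
Qed.
End Realization.

Section Pieces.
Variables (F : fieldType) (V : lmodType F) (X Y Z : V -> V).
Implicit Types (W U : V -> Prop) (M : bimod F).

Definition intertwines W M (f : V -> 'cV[F]_(bdim M)) := forall w, W w ->
  f (X w) = bX M *m f w /\ f (Y w) = bY M *m f w /\ f (Z w) = bZ M *m f w.

(** [W'] records where preimages can be found. Surjectivity already on a smaller submodule is what
    allows two quotient maps to be combined in [piece_sum]. *)
Definition piece W U W' M := exists f : {linear V -> 'cV[F]_(bdim M)},
  [/\ intertwines W f, forall w, W w -> (f w = 0 <-> U w) & forall u, exists2 w, W' w & f w = u].

Lemma glue m (W U W' : V -> Prop) (f0 f1 : V -> 'cV[F]_m) (LX LY LZ X' Y' Z' : 'M[F]_m) :
  linear f0 -> linear f1 ->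
  intertwines (M := BIMod LX LY LZ) W f0 -> intertwines (M := BIMod LX LY LZ) W f1 ->
  bi_sim LX LY LZ X' Y' Z' ->
  (forall w, W w -> (f0 w = 0 /\ f1 w = 0 <-> U w)) ->
  (forall u0 u1, exists2 w, W' w & f0 w = u0 /\ f1 w = u1) ->
  piece W U W' (bisum (BIMod X' Y' Z') (BIMod X' Y' Z')).
Proof.
move=> lin0 lin1 int0 int1 [T uT [TX TY TZ]] ker surj.
pose f w := col_mx (T *m f0 w) (T *m f1 w).
have flin : linear f.
  move=> r v w; rewrite /f lin0 lin1 !mulmxDr -!scalemxAr.
  by rewrite scale_col_mx add_col_mx.
pose fL : {linear V -> 'cV[F]_(m + m)} :=
  HB.pack f (GRing.isLinear.Build F V 'cV[F]_(m + m) *:%R f flin).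
have blk (A A' : 'M[F]_m) g0 g1 h0 h1 : T *m A = A' *m T -> g0 = A *m h0 -> g1 = A *m h1 ->
    col_mx (T *m g0) (T *m g1) = block_mx A' 0 0 A' *m col_mx (T *m h0) (T *m h1) :> 'cV[F]_(m + m).
  move=> TA -> ->; rewrite mul_block_col !mul0mx addr0 add0r.
  by rewrite !mulmxA TA.
exists fL; split=> [w Ww|w Ww|u].
- have [X0 [Y0 Z0]] := int0 _ Ww; have [X1 [Y1 Z1]] := int1 _ Ww.
  by split; [|split]; [exact: blk TX X0 X1|exact: blk TY Y0 Y1|exact: blk TZ Z0 Z1].
- rewrite -ker //; split=> [fw0|[w0 w1]]; last first.
    by rewrite -[LHS]/(f w) /f w0 w1 !mulmx0 col_mx0.
  have /eqP : f w = 0 by [].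
  rewrite /f -[0]col_mx0 => /eqP/eq_col_mx[e0 e1].
  by split; [rewrite -(mulKmx uT (f0 w)) e0 mulmx0|rewrite -(mulKmx uT (f1 w)) e1 mulmx0].
- have [w W'w [w0 w1]] := surj (invmx T *m usubmx u) (invmx T *m dsubmx u).
  by exists w => //; rewrite -[LHS]/(f w) /f w0 w1 !mulKVmx // vsubmxK.
Qed.

Definition bistable W := forall w, W w -> W (X w) /\ W (Y w) /\ W (Z w).

Lemma piece_subquot W U W' M : bistable W -> (forall w, W' w -> W w) ->
  piece W U W' M -> bi_subquot_iso X Y Z W U M.
Proof.
move=> sW W'W [f [fi fk fs]]; exists f; split=> //; split=> // u.
by have [w /W'W Ww fw] := fs u; exists w.
Qed.

(** The kernel of an intertwining map is stable, so stability of each [Mnx k n i] comes for free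
    from the quotient that it defines. *)
Lemma piece_stable W U W' M : bistable W -> piece W U W' M ->
  bistable (fun w => W w /\ U w).
Proof.
move=> sW [f [fi fk _]] w [Ww /(fk w Ww) fw].
have [WX [WY WZ]] := sW w Ww; have [fX [fY fZ]] := fi w Ww.
by split; [|split]; split=> //; apply/fk => //; rewrite ?fX ?fY ?fZ fw mulmx0.
Qed.

(** A Chinese remainder argument: preimages for one map are chosen in the kernel of the other, so
    their sum has prescribed images under both. *)
Lemma piece_sum W U1 U2 W1 W2 W' M1 M2 :
  (forall v w, W' v -> W' w -> W' (v + w)) ->
  (forall w, W' w -> W w) -> bistable W' ->
  (forall w, W1 w -> W' w /\ U2 w) -> (forall w, W2 w -> W' w /\ U1 w) ->
  piece W U1 W1 M1 -> piece W U2 W2 M2 ->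
  bi_subquot_iso X Y Z W' (fun w => U1 w /\ U2 w) (bisum M1 M2).
Proof.
move=> addW W'W sW' h1 h2 [f1 [i1 k1 s1]] [f2 [i2 k2 s2]].
pose f w := col_mx (f1 w) (f2 w).
have flin : linear f.
  by move=> r v w; rewrite /f !linearP scale_col_mx add_col_mx.
pose fL : {linear V -> 'cV[F]_(bdim M1 + bdim M2)} :=
  HB.pack f (GRing.isLinear.Build F V 'cV[F]_(bdim M1 + bdim M2) *:%R f flin).
exists fL; split=> //; split=> [u|].
  have [v Wv v1] := s1 (usubmx u); have [w Ww w2] := s2 (dsubmx u).
  have [W'v U2v] := h1 _ Wv; have [W'w U1w] := h2 _ Ww.
  exists (v + w); first exact: addW.
  rewrite -[LHS]/(f _) /f !raddfD /= v1 w2.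
  by rewrite ((k1 _ (W'W _ W'w)).2 U1w) ((k2 _ (W'W _ W'v)).2 U2v) addr0 add0r vsubmxK.
split=> [w /W'W Ww|w /W'W Ww].
  rewrite -k1 // -k2 //; split=> [fw0|[w1 w2]]; last by rewrite -[LHS]/(f w) /f w1 w2 col_mx0.
  have /eqP : f w = 0 by [].
  by rewrite /f -[0]col_mx0 => /eqP/eq_col_mx.
have [X1 [Y1 Z1]] := i1 _ Ww; have [X2 [Y2 Z2]] := i2 _ Ww.
have blk (A1 : 'M[F]_(bdim M1)) (A2 : 'M[F]_(bdim M2)) g1 g2 : g1 = A1 *m f1 w -> g2 = A2 *m f2 w ->
    col_mx g1 g2 = block_mx A1 0 0 A2 *m f w.
  by move=> -> ->; rewrite mul_block_col !mul0mx addr0 add0r.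
by split; [|split]; [exact: blk X1 X2|exact: blk Y1 Y2|exact: blk Z1 Z2].
Qed.
End Pieces.

Section LineRealization.
Variables (R : realType) (k : 'I_3 -> R) (q1 q2 p : 'I_3) (n t1 t2 t3 : nat).
Hypotheses (tp1 : tpar (k q1) = Some t1) (tp2 : tpar (k q2) = Some t2)
  (tp3 : tpar (k p) = Some t3) (n_odd : odd n).
Local Notation C := (R[i]).
Variables (V : lmodType C) (F : V -> nat -> nat -> nat -> C * C) (P Q S : V -> V).
Variables (W U W' : V -> Prop) (G : nat -> nat -> Prop).
Hypothesis WP : forall w, W w -> W (P w).
Hypothesis WQ : forall w, W w -> W (Q w).
Local Notation lf := (lf t3 F).
Hypothesis lf_linear : forall e a b r v w, lf e a b (r *: v + w) = r * lf e a b v + lf e a b w.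
Hypothesis P_line : forall e a b w, W w -> G a b -> lf e a b (P w) =
  diag R t3 t2 b * lf e a b w + (if b is b'.+1 then hopP k q1 e a b * lf e a.+1 b' w else 0).
Hypothesis Q_line : forall e a b w, W w -> G a b -> lf e a b (Q w) =
  diag R t3 t1 a * lf e a b w + (if a is a'.+1 then hopQ k q2 e a b * lf e a' b.+1 w else 0).
Hypothesis S_line : forall e a b w, W w -> G a b -> (a + b + t3)%N = n ->
  lf e a b (S w) = lf e a b (P (Q w)) + lf e a b (Q (P w)) - lkap R n t1 t2 t3 * lf e a b w.

Variables (d a0 b0 : nat) (a b c : C).
Hypothesis d_even : ~~ odd d.
Hypothesis ab0 : (a0 + b0 + t3)%N = n.

Lemma ab0_parity : odd a0 = odd b0.
Proof.
have [o3 _] := tparP tp3; move: n_odd; rewrite -ab0 !oddD o3.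
by case: (odd a0); case: (odd b0).
Qed.

Lemma lf_pair w x y : (lf false x y w = 0 /\ lf true x y w = 0) <-> F w x y t3 = (0, 0).
Proof.
rewrite /lf /comp; case: (F w x y t3) => s1 s2 /=.
by split=> [[-> ->]|[-> ->]].
Qed.

Definition realization X Y Z := exists f0 f1 : V -> 'cV[C]_d.+1,
  [/\ linear f0, linear f1,
      forall f, f = f0 \/ f = f1 -> forall w, W w ->
        f (P w) = X *m f w /\ f (Q w) = Y *m f w /\ f (S w) = Z *m f w,
      forall w, W w -> (f0 w = 0 /\ f1 w = 0 <-> U w) &
      forall u0 u1, exists2 w, W' w & f0 w = u0 /\ f1 w = u1].

Section Up.
Hypothesis d_b0 : (d <= b0)%N.
Hypothesis G_line : forall j, (j <= d)%N -> G (a0 + j) (b0 - j).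
Hypothesis stop_end : b0 = d \/ lam k q1 (a0 + d).+1 = 0.
Hypothesis stop_start : a0 = 0%N \/ lam k q2 b0.+1 = 0.
Hypothesis diagP : forall j, (j <= d)%N -> diag R t3 t2 (b0 - j) = Otheta d a j.
Hypothesis diagQ : forall j, (j <= d)%N -> diag R t3 t1 (a0 + j) = beta d b j.
Hypothesis lkapE : lkap R n t1 t2 t3 = kap d a b c.
Hypothesis zetaE : forall j, (j < d)%N ->
  - (lam k q1 (a0 + j).+1 * lam k q2 (b0 - j)) = zeta d a b c j.+1.
Hypothesis lam1_neq0 : forall j, (j < d)%N -> lam k q1 (a0 + j).+1 != 0.
Hypothesis kerU : forall w, W w ->
  ((forall j, (j <= d)%N -> F w (a0 + j) (b0 - j) t3 = (0, 0)) <-> U w).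
Hypothesis surjW' : forall h : nat -> C * C, exists2 w, W' w &
  forall j, (j <= d)%N -> F w (a0 + j) (b0 - j) t3 = h j.

(** At the end of the segment [P] is stopped by an exponent 0 or a vanishing [lam], and so is [Q] at
    its start; no information on [w] outside the segment is needed. *)
Lemma line_real_up : realization (LX d a) (LY d a b c) (LZ d a b c).
Proof.
have h := ii R.
pose kf e j w := lf e (a0 + j) (b0 - j) w.
pose x e j := hopP k q1 e (a0 + j) (b0 - j); pose y e j := hopQ k q2 e (a0 + j) (b0 - j).
have kfl e j r v w : kf e j (r *: v + w) = r * kf e j v + kf e j w by exact: lf_linear.
have kfP e w j : W w -> (j <= d)%N -> kf e j (P w) =
    Otheta d a j * kf e j w + (if (j < d)%N then x e j * kf e j.+1 w else 0).
  move=> Ww led; rewrite /kf P_line ?diagP //; last exact: G_line.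
  congr (_ + _); case: ltnP => [ltd|ged].
    by rewrite /x /= addnS subnS; case: (b0 - j)%N (subn_gt0 j b0) => //; lia.
  have jd : j = d by lia.
  case E: (b0 - j)%N => [//|b']; case: stop_end => [bd|l0]; first by lia.
  by rewrite /hopP jd l0 mulr0 mul0r.
have kfQ e w j : W w -> (j <= d)%N -> kf e j (Q w) =
    beta d b j * kf e j w + (if j is i.+1 then y e j * kf e i w else 0).
  move=> Ww led; rewrite /kf Q_line ?diagQ //; last exact: G_line.
  congr (_ + _); case: j led => [|j] led.
    rewrite addn0 subn0; case E: a0 => [//|a']; case: stop_start => [|l0]; first by lia.
    by rewrite /hopQ l0 mulr0 oppr0 mul0r.
  by rewrite addnS /y addnS (_ : (b0 - j.+1).+1 = b0 - j)%N //; lia.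
have kfS e w j : W w -> (j <= d)%N -> kf e j (S w) =
    kf e j (P (Q w)) + kf e j (Q (P w)) - kap d a b c * kf e j w.
  by move=> Ww led; rewrite /kf -lkapE; apply: S_line => //; [exact: G_line|lia].
(* The square of [ie e] is -1 for both values of [e], and the parity of [a0] and [b0] settles the
   rest. The product is the same for the two spin components, hence two isomorphic copies. *)
have xy e j : (j < d)%N -> x e j * y e j.+1 = zeta d a b c j.+1.
  move=> ltd; rewrite -zetaE // /x /y /hopP /hopQ /ie addnS.
  rewrite (_ : (b0 - j.+1).+1 = b0 - j)%N; last by lia.
  rewrite -!(signr_odd _ (b0 - j)) -!(signr_odd _ (a0 + j).+1) /= oddD oddB; last by lia.
  rewrite ab0_parity; case: e; case: (odd b0); case: (odd j) => /=;
    rewrite !(expr0, expr1); by ring: h.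
have x0 e j : (j < d)%N -> x e j != 0.
  by move=> ltd; rewrite /x /hopP /ie !mulf_neq0 ?signr_eq0 ?neq0Ci ?lam1_neq0.
have int e w : W w ->
    real d (kf e) (x e) (P w) = LX d a *m real d (kf e) (x e) w /\
    real d (kf e) (x e) (Q w) = LY d a b c *m real d (kf e) (x e) w /\
    real d (kf e) (x e) (S w) = LZ d a b c *m real d (kf e) (x e) w.
  move=> Ww; split; [|split].
  - exact: (real_LX (W := W) (P := P) (kfP e)).
  - exact: (real_LY (W := W) (Q := Q) d_even (kfQ e) (xy e)).
  - exact: (real_LZ (W := W) (P := P) (Q := Q) d_even WP WQ (kfP e) (kfQ e) (kfS e) (xy e)).
exists (real d (kf false) (x false)), (real d (kf true) (x true)); split.
- exact: real_linear.
- exact: real_linear.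
- by move=> f [->|->]; exact: int.
- move=> w Ww; rewrite -kerU // !real_eq0; [|exact: x0..]; split=> [[k0 k1] j led|w0].
    by apply/lf_pair; split; [exact: k0|exact: k1].
  by split=> j led; have /lf_pair[] := w0 j led.
- move=> u0 u1; have [w W'w wE] := surjW' (fun j =>
    ((wt (x false) j)^-1 * co u0 j, (wt (x true) j)^-1 * co u1 j)).
  exists w => //; split; apply: real_surj; try exact: x0.
    by move=> j led; rewrite /kf /lf wE.
  by move=> j led; rewrite /kf /lf wE.
Qed.
End Up.

Section Down.
Hypothesis d_a0 : (d <= a0)%N.
Hypothesis G_line : forall j, (j <= d)%N -> G (a0 - j) (b0 + j).
Hypothesis stop_end : forall w a', W w -> (a0 - d = a'.+1)%N -> F w a' (b0 + d).+1 t3 = (0, 0).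
Hypothesis stop_start : forall w b', W w -> (b0 = b'.+1)%N -> F w a0.+1 b' t3 = (0, 0).
Hypothesis diagQ : forall j, (j <= d)%N -> - diag R t3 t1 (a0 - j) = Otheta d a j.
Hypothesis diagP : forall j, (j <= d)%N -> - diag R t3 t2 (b0 + j) = beta d b j.
Hypothesis lkapE : lkap R n t1 t2 t3 = kap d a b c.
Hypothesis zetaE : forall j, (j < d)%N ->
  - (lam k q2 (b0 + j).+1 * lam k q1 (a0 - j)) = zeta d a b c j.+1.
Hypothesis lam2_neq0 : forall j, (j < d)%N -> lam k q2 (b0 + j).+1 != 0.
Hypothesis kerU : forall w, W w ->
  ((forall j, (j <= d)%N -> F w (a0 - j) (b0 + j) t3 = (0, 0)) <-> U w).
Hypothesis surjW' : forall h : nat -> C * C, exists2 w, W' w &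
  forall j, (j <= d)%N -> F w (a0 - j) (b0 + j) t3 = h j.
Hypothesis WN : forall w, W w -> W (- w).
Hypothesis PN : forall w, P (- w) = - P w.
Hypothesis QN : forall w, Q (- w) = - Q w.

(** Traversed in the other direction, [Q] goes forward along the segment. Both operators change sign
    to match [Otheta] and [beta], and the ends are closed by vanishing coefficients of [w] instead
    of vanishing factors. *)
Lemma line_real_down : realization (- LY d a b c) (- LX d a) (LZ d a b c).
Proof.
have h := ii R.
pose kf e j w := lf e (a0 - j) (b0 + j) w.
pose x e j := - hopQ k q2 e (a0 - j) (b0 + j); pose y e j := - hopP k q1 e (a0 - j) (b0 + j).
have kfl e j r v w : kf e j (r *: v + w) = r * kf e j v + kf e j w by exact: lf_linear.
have lf0 e a' b' : lf e a' b' 0 = 0.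
  by have := lf_linear e a' b' (-1) 0 0; rewrite scaler0 addr0 mulN1r addNr.
have lfN e a' b' w : lf e a' b' (- w) = - lf e a' b' w.
  by have := lf_linear e a' b' (-1) w 0; rewrite addr0 scaleN1r lf0 addr0 mulN1r.
have kfQ e w j : W w -> (j <= d)%N -> kf e j (- Q w) =
    Otheta d a j * kf e j w + (if (j < d)%N then x e j * kf e j.+1 w else 0).
  move=> Ww led; rewrite /kf lfN Q_line //; last exact: G_line.
  rewrite opprD -mulNr diagQ //; congr (_ + _); case: ltnP => [ltd|ged].
    rewrite /x addnS mulNr; case E: (a0 - j)%N => [|a']; first by lia.
    by rewrite (_ : a0 - j.+1 = a')%N //; lia.
  have jd : j = d by lia.
  case E: (a0 - j)%N => [|a']; rewrite ?oppr0 // jd /lf stop_end //; last by rewrite -jd.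
  by rewrite /comp if_same mulr0 oppr0.
have kfP e w j : W w -> (j <= d)%N -> kf e j (- P w) =
    beta d b j * kf e j w + (if j is i.+1 then y e j * kf e i w else 0).
  move=> Ww led; rewrite /kf lfN P_line //; last exact: G_line.
  rewrite opprD -mulNr diagP //; congr (_ + _); case: j led => [|j] led.
    rewrite addn0 subn0; case E: b0 => [|b']; rewrite ?oppr0 // /lf stop_start //.
    by rewrite /comp if_same mulr0 oppr0.
  by rewrite addnS /y addnS mulNr (_ : (a0 - j.+1).+1 = a0 - j)%N //; lia.
have kfS e w j : W w -> (j <= d)%N -> kf e j (S w) =
    kf e j (- Q (- P w)) + kf e j (- P (- Q w)) - kap d a b c * kf e j w.
  move=> Ww led; rewrite PN QN !opprK addrC [_ + kf e j _]addrC addrC /kf -lkapE.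
  by apply: S_line => //; [exact: G_line|lia].
have xy e j : (j < d)%N -> x e j * y e j.+1 = zeta d a b c j.+1.
  move=> ltd; rewrite -zetaE // /x /y /hopP /hopQ /ie addnS.
  rewrite (_ : (a0 - j.+1).+1 = a0 - j)%N; last by lia.
  rewrite -!(signr_odd _ (a0 - j)) -!(signr_odd _ (b0 + j).+1) /= oddD oddB; last by lia.
  rewrite ab0_parity; case: e; case: (odd b0); case: (odd j) => /=;
    rewrite !(expr0, expr1); by ring: h.
have x0 e j : (j < d)%N -> x e j != 0.
  by move=> ltd; rewrite /x /hopQ /ie opprK !mulf_neq0 ?signr_eq0 ?neq0Ci ?lam2_neq0.
have WQ' w : W w -> W (- Q w) by move=> /WQ/WN.
have WP' w : W w -> W (- P w) by move=> /WP/WN.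
have realN e w : real d (kf e) (x e) (- w) = - real d (kf e) (x e) w.
  by apply/matrixP => i j; rewrite !mxE /kf lfN mulrN.
have int e w : W w ->
    real d (kf e) (x e) (P w) = - LY d a b c *m real d (kf e) (x e) w /\
    real d (kf e) (x e) (Q w) = - LX d a *m real d (kf e) (x e) w /\
    real d (kf e) (x e) (S w) = LZ d a b c *m real d (kf e) (x e) w.
  move=> Ww; split; [|split].
  - rewrite mulNmx -(real_LY (W := W) (Q := fun w => - P w) d_even (kfP e) (xy e)) //.
    by rewrite realN opprK.
  - rewrite mulNmx -(real_LX (W := W) (P := fun w => - Q w) (kfQ e)) //.
    by rewrite realN opprK.
  - exact: (real_LZ (W := W) (P := fun w => - Q w) (Q := fun w => - P w)
      d_even WQ' WP' (kfQ e) (kfP e) (kfS e) (xy e)).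
exists (real d (kf false) (x false)), (real d (kf true) (x true)); split.
- exact: real_linear.
- exact: real_linear.
- by move=> f [->|->]; exact: int.
- move=> w Ww; rewrite -kerU // !real_eq0; [|exact: x0..]; split=> [[k0 k1] j led|w0].
    by apply/lf_pair; split; [exact: k0|exact: k1].
  by split=> j led; have /lf_pair[] := w0 j led.
- move=> u0 u1; have [w W'w wE] := surjW' (fun j =>
    ((wt (x false) j)^-1 * co u0 j, (wt (x true) j)^-1 * co u1 j)).
  exists w => //; split; apply: real_surj; try exact: x0.
    by move=> j led; rewrite /kf /lf wE.
  by move=> j led; rewrite /kf /lf wE.
Qed.
End Down.
End LineRealization.

(** * Nonvanishing of the parameters *)

Section Conditions.
Variable C : numFieldType.
Implicit Types (x y : C) (d n : nat).

(** Each eigenvalue difference or split parameter is, up to sign, a difference of two naturals or a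
    product of two such; exhibiting the naturals reduces its nonvanishing to integer arithmetic. *)
Lemma natsub_neq0 x (m1 m2 : nat) : m1 != m2 -> x = m1%:R - m2%:R -> x != 0.
Proof. by move=> m12 ->; rewrite subr_eq0 eqr_nat. Qed.

Lemma natsub_neq x y (m1 m2 : nat) : m1 != m2 -> x - y = m1%:R - m2%:R -> x != y.
Proof. by move=> m12 xy; rewrite -subr_eq0; apply: natsub_neq0 m12 xy. Qed.

Lemma natsubM_neq0 x (m1 m2 m3 m4 : nat) : m1 != m2 -> m3 != m4 ->
  x = (m1%:R - m2%:R) * (m3%:R - m4%:R) -> x != 0.
Proof. by move=> m12 m34 ->; rewrite mulf_neq0 // subr_eq0 eqr_nat. Qed.

Lemma natsubMN_neq0 x (m1 m2 m3 m4 : nat) : m1 != m2 -> m3 != m4 ->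
  x = - ((m1%:R - m2%:R) * (m3%:R - m4%:R)) -> x != 0.
Proof. by move=> m12 m34 ->; rewrite oppr_eq0 mulf_neq0 // subr_eq0 eqr_nat. Qed.

(** In order: the chain stops after [d] steps, [LY] climbs the chain, [LY] generates everything from
    [ev F d 0], and factors in [LX] isolate [ev F d 0]. *)
Definition regular d (a b c : C) :=
  [/\ forall j, (j <= d)%N -> beta d b d.+1 != beta d b j,
      forall j, (0 < j <= d)%N -> psi d a b c j != 0,
      forall j, (0 < j <= d)%N -> zeta d a b c j != 0 &
      forall j, (0 < j <= d)%N -> Otheta d a j != Otheta d a 0].

(** The bound on [n] acts through factors such as [j + t3 - (n + 1)] and [j + t2 + t3 - (n + 1)] of
    [zeta], which it keeps negative. *)
Lemma regular_A d n t2 t3 : ~~ odd d -> (d.+1 + t2 + t3 <= n)%N ->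
  regular d ((d.+1 + t2 + t3)%:R / 2 - n%:R - 1 : C) (- (t3%:R / 2)) (- (t2%:R / 2)).
Proof.
move=> ed len; split=> j.
- move=> lej; rewrite /beta !sign_parity /= ed -!natr1.
  have [oj|ej] := boolP (odd j).
    by apply: (@natsub_neq _ _ d.+1 j); [lia|rewrite -!natr1; field].
  by apply: (@natsub_neq _ _ (t3 + 1 + j) 0); [lia|rewrite !natrD; field].
- move=> /andP[j0 lej]; rewrite /psi; have [oj|ej] := boolP (odd j).
    apply: (@natsubM_neq0 _ d.+1 j (j + n + 1) d.+1); [lia|lia|].
    by rewrite !natrD -!natr1; field.
  apply: (@natsubMN_neq0 _ j 0 (j + n + 1) (d.+1 + t2)); [lia|lia|].
  by rewrite !natrD -!natr1; field.
- move=> /andP[j0 lej]; rewrite /zeta /psi; have [oj|ej] := boolP (odd j).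
    apply: (@natsubMN_neq0 _ d.+1 j (j + t3) (n + 1)); [lia|lia|].
    by rewrite !natrD -!natr1; field.
  apply: (@natsubM_neq0 _ j 0 (j + t2 + t3) (n + 1)); [lia|lia|].
  by rewrite !natrD -!natr1; field.
- move=> /andP[j0 lej]; rewrite /Otheta !sign_parity /=.
  have [oj|ej] := boolP (odd j).
    apply: (@natsub_neq _ _ (2 * n + 1) (t2 + t3 + j)); [lia|].
    by rewrite !natrD ?natrM -!natr1; field.
  by apply: (@natsub_neq _ _ j 0); [lia|rewrite !natrD -!natr1; field].
Qed.

Lemma regular_B d n t1 t3 : ~~ odd d -> (t1 + d.+1 + t3 <= n)%N ->
  regular d (- (t3%:R / 2) : C) ((t1 + d.+1 + t3)%:R / 2 - n%:R - 1) (- (t1%:R / 2)).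
Proof.
move=> ed len; split=> j.
- move=> lej; rewrite /beta !sign_parity /= ed -!natr1.
  have [oj|ej] := boolP (odd j).
    by apply: (@natsub_neq _ _ d.+1 j); [lia|rewrite !natrD -!natr1; field].
  apply: (@natsub_neq _ _ (2 * n + 3 + j) (t1 + d.+1 + t3)); [lia|].
  by rewrite !natrD ?natrM -!natr1; field.
- move=> /andP[j0 lej]; rewrite /psi; have [oj|ej] := boolP (odd j).
    apply: (@natsubM_neq0 _ d.+1 j (j + n + 1) d.+1); [lia|lia|].
    by rewrite !natrD -!natr1; field.
  apply: (@natsubMN_neq0 _ j 0 (j + n + 1) (d.+1 + t1)); [lia|lia|].
  by rewrite !natrD -!natr1; field.
- move=> /andP[j0 lej]; rewrite /zeta /psi; have [oj|ej] := boolP (odd j).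
    apply: (@natsubMN_neq0 _ d.+1 j (j + n + 1) (t1 + d.+1 + t3)); [lia|lia|].
    by rewrite !natrD -!natr1; field.
  apply: (@natsubM_neq0 _ j 0 (j + n + 1) (d.+1 + t3)); [lia|lia|].
  by rewrite !natrD -!natr1; field.
- move=> /andP[j0 lej]; rewrite /Otheta !sign_parity /=.
  have [oj|ej] := boolP (odd j).
    by apply: (@natsub_neq _ _ (t3 + d) j); [lia|rewrite !natrD; field].
  by apply: (@natsub_neq _ _ j 0); [lia|field].
Qed.

Lemma beta_end_B d t3 j : ~~ odd d -> (j <= d)%N ->
  beta d (- (t3%:R / 2) : C) d.+1 != Otheta d (- (t3%:R / 2)) j.
Proof.
move=> ed lej; rewrite /beta /Otheta !sign_parity /= ed -natr1.
have [oj|ej] := boolP (odd j).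
  by apply: (@natsub_neq _ _ (1 + j) 0); [lia|rewrite natrD; field].
by apply: (@natsub_neq _ _ (t3 + d + 1) j); [lia|rewrite !natrD; field].
Qed.

Lemma regular_W d t1 t2 t3 (N : C) : ~~ odd d -> N = (t1 + t2 + t3 + d).+1%:R / 2 ->
  (0 < t1)%N -> (0 < t3)%N ->
  regular d (- (- (t2%:R / 2) + N)) (- (- (t1%:R / 2) + N)) (- (t3%:R / 2) + N).
Proof.
move=> ed -> t1p t3p; rewrite -addn1 !natrD; split=> j.
- move=> lej; rewrite /beta !sign_parity /= ed -!natr1.
  have [oj|ej] := boolP (odd j).
    by apply: (@natsub_neq _ _ d.+1 j); [lia|rewrite -!natr1; field].
  by apply: (@natsub_neq _ _ (t2 + t3 + d + 2 + j) 0); [lia|rewrite !natrD; field].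
- move=> /andP[j0 lej]; rewrite /psi; have [oj|ej] := boolP (odd j).
    apply: (@natsubM_neq0 _ d.+1 j (j + t3) 0); [lia|lia|].
    by rewrite !natrD -!natr1; field.
  apply: (@natsubMN_neq0 _ j 0 (j + (t1 + t2 + t3 + d) + 1) 0); [lia|lia|].
  by rewrite !natrD; field.
- move=> /andP[j0 lej]; rewrite /zeta /psi; have [oj|ej] := boolP (odd j).
    apply: (@natsubMN_neq0 _ d.+1 j (j + t2) 0); [lia|lia|].
    by rewrite !natrD -!natr1; field.
  apply: (@natsubM_neq0 _ j 0 j (d + 1 + t1)); [lia|lia|].
  by rewrite !natrD; field.
- move=> /andP[j0 lej]; rewrite /Otheta !sign_parity /=.
  have [oj|ej] := boolP (odd j).
    by apply: (@natsub_neq _ _ (t1 + t3 + d + 1 + d) j); [lia|rewrite !natrD; field].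
  by apply: (@natsub_neq _ _ j 0); [lia|field].
Qed.
End Conditions.

(** * Submodules and their quotients *)

Lemma cyc_rot (q1 q2 p : 'I_3) : cyc q1 q2 p -> cyc q2 p q1.
Proof. by case=> -[-> -> ->]; [constructor 2|constructor 3|constructor 1]. Qed.

Section Membership.
Variables (R : realType) (k : 'I_3 -> R) (q1 q2 p : 'I_3) (n t1 t2 t3 : nat).
Hypothesis cycq : cyc q1 q2 p.
Hypotheses (tp1 : tpar (k q1) = Some t1) (tp2 : tpar (k q2) = Some t2)
  (tp3 : tpar (k p) = Some t3).
Local Notation C := (R[i]).
Local Notation V := (V R).
Implicit Types (v w : V).
Local Notation F := (sp q1 q2 p).

Lemma pair_eq0 (s : C * C) : s = (0, 0) <-> comp false s = 0 /\ comp true s = 0.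
Proof. by case: s => x y; rewrite /comp /=; split=> [[-> ->]|[-> ->]]. Qed.

Lemma sp_linear e (r : C) v w a b c :
  comp e (F (r *: v + w) a b c) = r * comp e (F v a b c) + comp e (F w a b c).
Proof.
rewrite /sp; set m := mon _ _ _ _ _ _.
have -> : (r *: v + w).1@_m = r * v.1@_m + w.1@_m.
  by apply: etrans (mcoeffD _ _ _) _; rewrite mcoeffZ.
have -> : (r *: v + w).2@_m = r * v.2@_m + w.2@_m.
  by apply: etrans (mcoeffD _ _ _) _; rewrite mcoeffZ.
gen_coef; rewrite /comp /spin; case: e; case: (val p) => [|[|?]] /=; ring.
Qed.

Lemma Mn_linear (r : C) v w : Mn k n v -> Mn k n w -> Mn k n (r *: v + w).
Proof.
move=> Mv Mw; apply/(MnP k cycq); split=> [a b c nabc|a b c].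
  apply/pair_eq0; rewrite !sp_linear.
  by rewrite (Mn_degree cycq Mv nabc) (Mn_degree cycq Mw nabc) /comp /= mulr0 addr0.
have v1 := Mn_dirac1 cycq a b c Mv; have v2 := Mn_dirac2 cycq a b c Mv.
have w1 := Mn_dirac1 cycq a b c Mw; have w2 := Mn_dirac2 cycq a b c Mw.
rewrite sp_dirac //.
have E1 a' b' c' : (F (r *: v + w) a' b' c').1 = r * (F v a' b' c').1 + (F w a' b' c').1.
  exact: (sp_linear false).
have E2 a' b' c' : (F (r *: v + w) a' b' c').2 = r * (F v a' b' c').2 + (F w a' b' c').2.
  exact: (sp_linear true).
move: v1 v2 w1 w2 E1 E2; generalize (F (r *: v + w)) (F v) (F w).
move=> f0 f g v1 v2 w1 w2 E1 E2; rewrite !E1 !E2; congr (_, _).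
  by apply: (lincomb3 (c1 := r) (c2 := 1) (c3 := 0) v1 w1 v1); ring.
by apply: (lincomb3 (c1 := r) (c2 := 1) (c3 := 0) v2 w2 v2); ring.
Qed.

Lemma biop_opp w : biop k q1 q2 p (- w) = - biop k q1 q2 p w.
Proof.
apply/eqP; rewrite -addr_eq0 addrC -[biop k q1 q2 p w]scale1r; apply/eqP.
apply/(sp_coef0 cycq) => a b c.
have E e a' b' c' : comp e (F (- w) a' b' c') = - comp e (F w a' b' c').
  have := sp_linear e (-1) w w a' b' c'; rewrite scaleN1r addNr mulN1r addNr => E0.
  have := sp_linear e (-1) w 0 a' b' c'; rewrite scaleN1r addr0 mulN1r => ->.
  by rewrite ((sp_coef0 cycq 0).2 (erefl _)) /comp if_same addr0.
have E1 a' b' c' : (F (- w) a' b' c').1 = - (F w a' b' c').1 by exact: (E false).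
have E2 a' b' c' : (F (- w) a' b' c').2 = - (F w a' b' c').2 by exact: (E true).
suff P0 e : comp e (F (biop k q1 q2 p w) a b c) + comp e (F (biop k q1 q2 p (- w)) a b c) = 0.
  apply/pair_eq0; split; first by apply: etrans (sp_linear _ _ _ _ _ _ _) _; rewrite mul1r P0.
  by apply: etrans (sp_linear _ _ _ _ _ _ _) _; rewrite mul1r P0.
have B := sp_biop1 k cycq w a b c; have B' := sp_biop1 k cycq (- w) a b c.
move: B B' E1 E2; generalize (F (biop k q1 q2 p w) a b c) (F (biop k q1 q2 p (- w)) a b c).
generalize (F (- w)) (F w) (bisign k q2 p b c) => f g y s s' -> -> /= E1 E2.
rewrite /comp /hop !E1 !E2; move: (_ ^+ _) => z.
by case: e; case: ifP => _; case: ifP => _ /=; ring.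
Qed.

Lemma MnxE i t w : tpar (k i) = Some t ->
  (Mnx k n i w <-> Mn k n w /\ forall m : 'X_{1..3}, (m i < t)%N -> w.1@_m = 0 /\ w.2@_m = 0).
Proof.
move=> ti; rewrite /Mnx ti; split=> -[Mw hw]; split=> // m hm.
  split; apply/eqP; rewrite mcoeff_eq0; apply/negP => sm.
    by have := hw m; rewrite sm leqNgt hm => /(_ isT).
  by have := hw m; rewrite sm orbT leqNgt hm => /(_ isT).
rewrite leqNgt; apply/negP => /hw[w1 w2].
by move: hm; rewrite !mcoeff_msupp w1 w2 eqxx.
Qed.

Lemma Mnx1P w : Mnx k n q1 w <-> Mn k n w /\ forall a b c, (a < t1)%N -> F w a b c = (0, 0).
Proof.
have [n12 n1p n2p] := cyc_neq cycq; rewrite (MnxE _ tp1); split=> -[Mw hw]; split=> //.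
  by move=> a b c at1; apply/sp_eq0/hw; rewrite (mon1 n12 n1p n2p).
by move=> m mt; rewrite [m](monE n12 n1p n2p m); apply/(sp_eq0 _ _ _ w (m q1) (m q2) (m p))/hw.
Qed.

Lemma Mnx2P w : Mnx k n q2 w <-> Mn k n w /\ forall a b c, (b < t2)%N -> F w a b c = (0, 0).
Proof.
have [n12 n1p n2p] := cyc_neq cycq; rewrite (MnxE _ tp2); split=> -[Mw hw]; split=> //.
  by move=> a b c at1; apply/sp_eq0/hw; rewrite (mon2 n12 n1p n2p).
by move=> m mt; rewrite [m](monE n12 n1p n2p m); apply/(sp_eq0 _ _ _ w (m q1) (m q2) (m p))/hw.
Qed.

Lemma Mnx3P w : Mnx k n p w <-> Mn k n w /\ forall a b c, (c < t3)%N -> F w a b c = (0, 0).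
Proof.
have [n12 n1p n2p] := cyc_neq cycq; rewrite (MnxE _ tp3); split=> -[Mw hw]; split=> //.
  by move=> a b c at1; apply/sp_eq0/hw; rewrite (mon3 n12 n1p n2p).
by move=> m mt; rewrite [m](monE n12 n1p n2p m); apply/(sp_eq0 _ _ _ w (m q1) (m q2) (m p))/hw.
Qed.
End Membership.

Lemma Mnx_linear (R : realType) (k : 'I_3 -> R) n i t (r : R[i]) (v w : V R) :
  tpar (k i) = Some t -> Mnx k n i v -> Mnx k n i w -> Mnx k n i (r *: v + w).
Proof.
move=> ti /(MnxE _ _ ti)[Mv hv] /(MnxE _ _ ti)[Mw hw]; apply/(MnxE _ _ ti); split.
  by apply: (@Mn_linear _ _ 0 1 2) => //; constructor 1.
move=> m hm; have [v1 v2] := hv m hm; have [w1 w2] := hw m hm.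
split; apply: etrans (mcoeffD _ _ _) _; rewrite mcoeffZ.
  by rewrite v1 w1 mulr0 addr0.
by rewrite v2 w2 mulr0 addr0.
Qed.

(** A rotation of the axes changes the spin eigenbasis, so individual components do not correspond;
    the vanishing of both does. *)
Lemma sp_rot_eq0 (R : realType) (q1 q2 p : 'I_3) (w : V R) a b c :
  sp q2 p q1 w b c a = (0, 0) <-> sp q1 q2 p w a b c = (0, 0).
Proof.
have E : mon q2 p q1 b c a = mon q1 q2 p a b c.
  by apply/mnmP => i; rewrite /mon !mnmDE addnC addnA.
by rewrite !sp_eq0 E.
Qed.

(** * The arms and the core as line modules *)

Section Instances.
Variables (R : realType) (k : 'I_3 -> R) (q1 q2 p : 'I_3) (n t1 t2 t3 : nat).
Hypothesis cycq : cyc q1 q2 p.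
Hypotheses (tp1 : tpar (k q1) = Some t1) (tp2 : tpar (k q2) = Some t2)
  (tp3 : tpar (k p) = Some t3) (n_odd : odd n) (t_le_n : (t1 + t2 + t3 <= n)%N).
Local Notation C := (R[i]).
Local Notation V := (V R).
Implicit Types (v w : V).
Local Notation F := (sp q1 q2 p).
Local Notation P := (biop k q1 q2 p).
Local Notation Q := (biop k q2 p q1).
Local Notation S := (biop k p q1 q2).
Local Opaque sp biop.

Lemma Mn_vanish13 w a b c : Mn k n w -> (a < t1)%N -> (c < t3)%N -> F w a b c = (0, 0).
Proof.
move=> Mw at1 ct3; apply/sp_rot_eq0.
apply: (Mn_vanish (cyc_rot (cyc_rot cycq)) tp3 tp1 tp2 b _ Mw ct3 at1); lia.
Qed.

Lemma Mn_vanish23 w a b c : Mn k n w -> (b < t2)%N -> (c < t3)%N -> F w a b c = (0, 0).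
Proof.
move=> Mw bt2 ct3; have [rot _] := sp_rot_eq0 q1 q2 p w a b c; apply: rot.
apply: (Mn_vanish (cyc_rot cycq) tp2 tp3 tp1 a _ Mw bt2 ct3); lia.
Qed.

Lemma line_witness lo hi (hh : nat -> C * C) : exists w, [/\ Mnx k n p w,
  forall a, (lo <= a <= hi)%N -> (a + t3 <= n)%N -> F w a (n - t3 - a) t3 = hh a,
  (t1 <= lo)%N -> Mnx k n q1 w & (hi + t2 + t3 <= n)%N -> Mnx k n q2 w].
Proof.
(* Restricting the data to degree [n] ties [b] to [a], so the upper bound [hi] on [a] becomes the
   lower bound [t2] on [b] needed for membership in [Mnx k n q2]. *)
pose h a b := if ((a + b + t3)%N == n) && (lo <= a <= hi)%N then hh a else (0, 0).
exists (ck_ext k q1 q2 p n t3 h); have Mw := Mn_ck_ext n cycq tp3 h.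
have Fw := sp_ck_ext k n t3 cycq h; split.
- by apply/(Mnx3P _ cycq tp3); split=> // a b c ct; rewrite Fw [(t3 <= c)%N]leqNgt ct andbF.
- move=> a hla at3; rewrite Fw leqnn subnn andbT (_ : (a + (n - t3 - a) + t3)%N = n); last by lia.
  by rewrite eqxx /= /h hla (_ : (a + (n - t3 - a) + t3)%N = n) ?eqxx //; lia.
- move=> t1lo; apply/(Mnx1P _ cycq tp1); split=> // a b c at1; rewrite Fw; case: ifP => // _.
  apply: (ck_supp1 _ _ _ tp1) => // a' b' at1'; rewrite /h.
  by case: ifP => // /andP[_ /andP[loa _]]; lia.
- move=> hin; apply/(Mnx2P _ cycq tp2); split=> // a b c bt2; rewrite Fw; case: ifP => // _.
  apply: (ck_supp2 _ _ _ tp2) => // a' b' bt2'; rewrite /h.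
  by case: ifP => // /andP[/eqP abn /andP[_ ahi]]; lia.
Qed.

Section Region.
Variables (W : V -> Prop) (G : nat -> nat -> Prop).
Hypothesis WM : forall w, W w -> Mn k n w.
Hypothesis Wv : forall w, W w -> vanishing t3 F G w.
Hypothesis WP : forall w, W w -> W (P w).
Hypothesis WQ : forall w, W w -> W (Q w).
Hypothesis clG : lam_closed k q1 q2 G.
Hypothesis downG : forall a b, (G a.+1 b -> G a b) /\ (G a b.+1 -> G a b).

Let D1 w a b c (Mw : Mn k n w) := Mn_dirac1 cycq a b c Mw.
Let D2 w a b c (Mw : Mn k n w) := Mn_dirac2 cycq a b c Mw.

Lemma region_P e a b w : W w -> G a b -> lf t3 F e a b (P w) =
  diag R t3 t2 b * lf t3 F e a b w
  + (if b is b'.+1 then hopP k q1 e a b * lf t3 F e a.+1 b' w else 0).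
Proof. by move=> Ww; exact: (line_P tp2 tp3 (sp_biop1 k cycq) D1 D2 clG e (WM Ww) (Wv Ww)). Qed.

Lemma region_Q e a b w : W w -> G a b -> lf t3 F e a b (Q w) =
  diag R t3 t1 a * lf t3 F e a b w
  + (if a is a'.+1 then hopQ k q2 e a b * lf t3 F e a' b.+1 w else 0).
Proof. by move=> Ww; exact: (line_Q tp1 tp3 (sp_biop2 k cycq) D1 D2 clG e (WM Ww) (Wv Ww)). Qed.

Lemma region_S e a b w : W w -> G a b -> (a + b + t3)%N = n ->
  lf t3 F e a b (S w) = lf t3 F e a b (P (Q w)) + lf t3 F e a b (Q (P w))
    - lkap R n t1 t2 t3 * lf t3 F e a b w.
Proof.
move=> Ww; exact: (line_S tp1 tp2 tp3 n_odd (sp_biop1 k cycq) (sp_biop2 k cycq) (sp_biop3 k cycq)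
  D1 D2 clG downG e (WM Ww) (WM (WP Ww)) (WM (WQ Ww)) (Wv Ww) (Wv (WP Ww)) (Wv (WQ Ww))).
Qed.
End Region.

Lemma lf_lin e a b (r : C) v w :
  lf t3 F e a b (r *: v + w) = r * lf t3 F e a b v + lf t3 F e a b w.
Proof. exact: sp_linear. Qed.

(** The arm [a < t1] meets the line in the segment [a = 0, ..., t1 - 1]; it is closed at [a = 0] by
    the exponent and at [a = d] by [lam k q1 t1 = 0]. *)
Lemma realization_first d : t1 = d.+1 ->
  let a : C := (d.+1 + t2 + t3)%:R / 2 - n%:R - 1 in
  let b : C := - (t3%:R / 2) in let c : C := - (t2%:R / 2) in
  realization P Q S (Mn k n) (Mnx k n q1) (fun w => Mnx k n q2 w /\ Mnx k n p w)
    (LX d a) (LY d a b c) (LZ d a b c).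
Proof.
move=> t1E a b c; have [o1 _] := tparP tp1; have [o2 _] := tparP tp2; have [o3 _] := tparP tp3.
have d_even : ~~ odd d by move: o1; rewrite t1E.
pose G := fun a' b' : nat => (a' < t1)%N.
have clG : lam_closed k q1 q2 G.
  move=> a' b' Ga; split; last by right.
  have [->|ne] := eqVneq a'.+1 t1; first by left; exact: lam_tpar.
  by right; move: Ga; rewrite /G; lia.
have downG a' b' : (G a'.+1 b' -> G a' b') /\ (G a' b'.+1 -> G a' b').
  by rewrite /G; split=> ?; lia.
have vG w : Mn k n w -> vanishing t3 F G w by move=> Mw a' b' c' Ga ct; exact: Mn_vanish13.
have WP w : Mn k n w -> Mn k n (P w) by exact: Mn_biop.
have WQ w : Mn k n w -> Mn k n (Q w) by exact: (Mn_biop (cyc_rot cycq)).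
pose b0 := (n - t3)%N.
have nE : n = (b0 + t3)%N by rewrite /b0; lia.
have b0_even : odd b0 = false by move: n_odd; rewrite nE oddD o3; case: (odd b0).
apply: (@line_real_up R k q1 q2 p n t1 t2 t3 tp3 n_odd _ F P Q S (Mn k n) (Mnx k n q1)
  (fun w => Mnx k n q2 w /\ Mnx k n p w) G WP WQ lf_lin
  (region_P (fun w Mw => Mw) vG clG) (region_Q (fun w Mw => Mw) vG clG)
  (region_S (fun w Mw => Mw) vG WP WQ clG downG) d 0 b0 a b c d_even).
- by rewrite add0n.
- by rewrite /b0; lia.
- by move=> j lej; rewrite /G; lia.
- by right; rewrite add0n -t1E; exact: lam_tpar.
- by left.
- move=> j lej; have jb : (j <= b0)%N by rewrite /b0; lia.
  rewrite /diag /Otheta /a nE !sign_parity oddB // b0_even /= natrB // !natrD -!natr1.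
  by case: (odd j) => /=; field.
- move=> j lej; rewrite /diag /beta /b add0n t1E !sign_parity -!natr1.
  by case: (odd j); field.
- by rewrite /lkap /kap /a /b /c t1E nE !natrD -!natr1; field.
- move=> j ltj; have jb : (j <= b0)%N by rewrite /b0; lia.
  rewrite add0n (lamE _ tp1) (lamE _ tp2) /zeta /psi /= oddB // b0_even /= natrB //.
  rewrite /a /b /c t1E nE !natrD -!natr1.
  by case: (odd j) => /=; field.
- by move=> j ltj; apply: lam_neq0 tp1 _ _; lia.
- move=> w Mw; split=> [w0|/(Mnx1P _ cycq tp1)[_ w0] j lej]; last by apply: w0; lia.
  (* On the arm the layers below [t3] vanish because two exponents are small, and the layer [t3] by
     assumption; the recursion clears all the others. *)
  apply/(Mnx1P _ cycq tp1); split=> // a' b' c' at1.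
  apply: (Mn_unique cycq tp3 clG Mw) at1 => a'' b'' c'' Ga.
  rewrite leq_eqVlt => /predU1P[->|ct]; last exact: Mn_vanish13.
  have [abn|] := eqVneq (a'' + b'' + t3)%N n; last exact: (Mn_degree cycq Mw).
  have := w0 a''; rewrite add0n (_ : b0 - a'' = b'')%N; last by rewrite /b0; lia.
  by apply; move: Ga; rewrite /G; lia.
- move=> h; have [w [M3 wE _ M2]] := line_witness 0 d h; exists w.
    by split=> //; apply: M2; lia.
  by move=> j lej; rewrite add0n; apply: wE; lia.
Qed.

Lemma realization_second d : t2 = d.+1 ->
  let a : C := - (t3%:R / 2) in let b : C := (t1 + d.+1 + t3)%:R / 2 - n%:R - 1 in
  let c : C := - (t1%:R / 2) in
  realization P Q S (Mn k n) (Mnx k n q2) (fun w => Mnx k n q1 w /\ Mnx k n p w)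
    (LX d a) (LY d a b c) (LZ d a b c).
Proof.
move=> t2E a b c; have [o1 _] := tparP tp1; have [o2 _] := tparP tp2; have [o3 _] := tparP tp3.
have d_even : ~~ odd d by move: o2; rewrite t2E.
pose G := fun a' b' : nat => (b' < t2)%N.
have clG : lam_closed k q1 q2 G.
  move=> a' b' Ga; split; first by right.
  have [->|ne] := eqVneq b'.+1 t2; first by left; exact: lam_tpar.
  by right; move: Ga; rewrite /G; lia.
have downG a' b' : (G a'.+1 b' -> G a' b') /\ (G a' b'.+1 -> G a' b').
  by rewrite /G; split=> ?; lia.
have vG w : Mn k n w -> vanishing t3 F G w by move=> Mw a' b' c' Ga ct; exact: Mn_vanish23.
have WP w : Mn k n w -> Mn k n (P w) by exact: Mn_biop.
have WQ w : Mn k n w -> Mn k n (Q w) by exact: (Mn_biop (cyc_rot cycq)).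
(* The segment is [b = d, ..., 0], so [a] starts at the value that makes the total degree [n] when
   [b = d]. *)
pose a0 := (n - t3 - d)%N.
have nE : n = (a0 + d + t3)%N by rewrite /a0; lia.
have a0_even : odd a0 = false.
  by move: n_odd; rewrite nE !oddD o3 (negPf d_even); case: (odd a0).
apply: (@line_real_up R k q1 q2 p n t1 t2 t3 tp3 n_odd _ F P Q S (Mn k n) (Mnx k n q2)
  (fun w => Mnx k n q1 w /\ Mnx k n p w) G WP WQ lf_lin
  (region_P (fun w Mw => Mw) vG clG) (region_Q (fun w Mw => Mw) vG clG)
  (region_S (fun w Mw => Mw) vG WP WQ clG downG) d a0 d a b c d_even).
- by [].
- by [].
- by move=> j lej; rewrite /G; lia.
- by left.
- by right; rewrite -t2E; exact: lam_tpar.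
- move=> j lej; rewrite /diag /Otheta /a t2E !sign_parity oddB // (negPf d_even) /= natrB //.
  by rewrite -!natr1; case: (odd j) => /=; field.
- move=> j lej; rewrite /diag /beta /b nE !sign_parity oddD a0_even /= !natrD -!natr1.
  by case: (odd j); field.
- by rewrite /lkap /kap /a /b /c t2E nE !natrD -!natr1; field.
- move=> j ltj; rewrite (lamE _ tp1) (lamE _ tp2) /zeta /psi /= oddB ?(ltnW ltj) //.
  rewrite oddD a0_even (negPf d_even) /= natrB ?(ltnW ltj) //.
  rewrite /a /b /c t2E nE !natrD -!natr1 !natrD.
  by case: (odd j) => /=; field.
- by move=> j ltj; apply: lam_neq0 tp1 _ _ => //; lia.
- move=> w Mw; split=> [w0|/(Mnx2P _ cycq tp2)[_ w0] j lej]; last by apply: w0; lia.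
  apply/(Mnx2P _ cycq tp2); split=> // a' b' c' bt2.
  apply: (Mn_unique cycq tp3 clG Mw) bt2 => a'' b'' c'' Ga.
  rewrite leq_eqVlt => /predU1P[->|ct]; last exact: Mn_vanish23.
  have [abn|] := eqVneq (a'' + b'' + t3)%N n; last exact: (Mn_degree cycq Mw).
  have := w0 (d - b'')%N.
  rewrite (_ : a0 + (d - b'') = a'')%N; last by move: Ga; rewrite /G /a0; lia.
  rewrite (_ : d - (d - b'') = b'')%N; last by move: Ga; rewrite /G; lia.
  by apply; lia.
- move=> h; have [w [M3 wE M1 _]] := line_witness a0 (a0 + d) (fun x => h (x - a0)%N).
  exists w; first by split=> //; apply: M1; rewrite /a0; lia.
  move=> j lej; have := wE (a0 + j)%N; rewrite addKn.
  by rewrite (_ : n - t3 - (a0 + j) = d - j)%N; [apply; lia|lia].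
Qed.

Definition inner w := Mnx k n q1 w /\ Mnx k n q2 w /\ Mnx k n p w.

(** Inside the core the coefficients with [a < t1] or [b < t2] are 0. This closes the segment from
    [(t1 + d, t2)] to [(t1, t2 + d)], which determines the whole element. *)
Lemma realization_inner d : n = (t1 + t2 + t3 + d)%N ->
  (forall w, inner w -> inner (P w)) -> (forall w, inner w -> inner (Q w)) ->
  let N : C := n.+1%:R / 2 in
  let a : C := - (- (t2%:R / 2) + N) in let b : C := - (- (t1%:R / 2) + N) in
  let c : C := - (t3%:R / 2) + N in
  realization P Q S inner (fun w => w = 0) inner (- LY d a b c) (- LX d a) (LZ d a b c).
Proof.
move=> nE WP WQ N a b c.
have [o1 _] := tparP tp1; have [o2 _] := tparP tp2; have [o3 _] := tparP tp3.
have d_even : ~~ odd d.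
  by move: n_odd; rewrite nE !oddD o1 o2 o3; case: (odd d).
pose G := fun a' b' : nat => True.
have clG : lam_closed k q1 q2 G by move=> a' b' _; split; right.
have downG a' b' : (G a'.+1 b' -> G a' b') /\ (G a' b'.+1 -> G a' b') by [].
have WM w : inner w -> Mn k n w by move=> [/(Mnx1P _ cycq tp1)[]].
have W1 w a' b' c' : inner w -> (a' < t1)%N -> F w a' b' c' = (0, 0).
  by move=> [/(Mnx1P _ cycq tp1)[_ w1] _]; exact: w1.
have W2 w a' b' c' : inner w -> (b' < t2)%N -> F w a' b' c' = (0, 0).
  by move=> [_ [/(Mnx2P _ cycq tp2)[_ w2] _]]; exact: w2.
have W3 w a' b' c' : inner w -> (c' < t3)%N -> F w a' b' c' = (0, 0).
  by move=> [_ [_ /(Mnx3P _ cycq tp3)[_ w3]]]; exact: w3.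
have vG w : inner w -> vanishing t3 F G w by move=> Ww a' b' c' _; exact: W3.
have WN w : inner w -> inner (- w).
  have N0 i t : tpar (k i) = Some t -> Mnx k n i w -> Mnx k n i (- w).
    move=> ti Mi; rewrite -[- w]addr0 -scaleN1r; apply: (Mnx_linear _ ti) => //.
    by rewrite -(addNr w) -scaleN1r; apply: (Mnx_linear _ ti).
  by move=> [/(N0 _ _ tp1) ? [/(N0 _ _ tp2) ? /(N0 _ _ tp3) ?]].
have noddE : odd (t1 + d) = true by rewrite oddD o1 (negPf d_even).
apply: (@line_real_down R k q1 q2 p n t1 t2 t3 tp3 n_odd _ F P Q S inner (fun w => w = 0)
  inner G WP WQ lf_lin (region_P WM vG clG) (region_Q WM vG clG)
  (region_S WM vG WP WQ clG downG) d (t1 + d) t2 a b c d_even).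
- by lia.
- by lia.
- by [].
- by move=> w a' Ww ad; apply: W1 => //; lia.
- by move=> w b' Ww bE; apply: W2 => //; lia.
- move=> j lej; rewrite /diag /Otheta /a /N nE !sign_parity oddB; last by lia.
  rewrite noddE natrB; last by lia.
  by rewrite -!natr1 !natrD; case: (odd j) => /=; field.
- move=> j lej; rewrite /diag /beta /b /N nE !sign_parity oddD o2 -!natr1 !natrD.
  by case: (odd j) => /=; field.
- by rewrite /lkap /kap /a /b /c /N nE -!natr1 !natrD; field.
- move=> j ltj; rewrite (lamE _ tp1) (lamE _ tp2) /zeta /psi /= oddB; last by lia.
  rewrite oddD o2 noddE /= natrB; last by lia.
  rewrite /a /b /c /N nE -!natr1 !natrD.
  by case: (odd j) => /=; field.
- by move=> j ltj; apply: lam_neq0 tp2 _ _; lia.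
- move=> w Ww; split=> [w0|->]; last by move=> j lej; exact: (sp_coef0 cycq 0).2.
  apply/(sp_coef0 cycq) => a' b' c'.
  apply: (Mn_unique cycq tp3 clG (WM _ Ww)) => // a'' b'' c'' _.
  rewrite leq_eqVlt => /predU1P[->|ct]; last exact: W3.
  have [lta|lea] := ltnP a'' t1; first exact: W1.
  have [ltb|leb] := ltnP b'' t2; first exact: W2.
  have [abn|] := eqVneq (a'' + b'' + t3)%N n; last exact: (Mn_degree cycq (WM _ Ww)).
  have := w0 (t1 + d - a'')%N.
  rewrite (_ : t1 + d - (t1 + d - a'') = a'')%N; last by lia.
  rewrite (_ : t2 + (t1 + d - a'') = b'')%N; last by lia.
  by apply; lia.
- move=> h; have [w [M3 wE M1 M2]] := line_witness t1 (t1 + d) (fun x => h (t1 + d - x)%N).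
  exists w; first by split; [exact: M1|split=> //; apply: M2; lia].
  move=> j lej; have := wE (t1 + d - j)%N.
  rewrite (_ : t1 + d - (t1 + d - j) = j)%N; last by lia.
  by rewrite (_ : n - t3 - (t1 + d - j) = t2 + j)%N; [apply; lia|lia].
- exact: WN.
- exact: biop_opp.
- exact: (biop_opp k (cyc_rot cycq)).
Qed.
End Instances.

(** * Assembly of the isomorphisms *)

Lemma realization_piece (R : realType) (V : lmodType R[i]) (P Q S : V -> V) (W U W' : V -> Prop) d
  (X Y Z X' Y' Z' : 'M[R[i]]_d.+1) :
  realization P Q S W U W' X Y Z -> bi_sim X Y Z X' Y' Z' ->
  piece P Q S W U W' (bisum (BIMod X' Y' Z') (BIMod X' Y' Z')).
Proof.
move=> [f0 [f1 [l0 l1 int ker surj]]] sim.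
by apply: (glue l0 l1 _ _ sim ker surj) => w Ww; apply: int => //; [left|right].
Qed.

Lemma realization_piece_rot (R : realType) (V : lmodType R[i]) (P Q S : V -> V)
  (W U W' : V -> Prop) d (X Y Z X' Y' Z' : 'M[R[i]]_d.+1) :
  realization P Q S W U W' X Y Z -> bi_sim Z X Y X' Y' Z' ->
  piece S P Q W U W' (bisum (BIMod X' Y' Z') (BIMod X' Y' Z')).
Proof.
move=> [f0 [f1 [l0 l1 int ker surj]]] sim.
apply: (glue l0 l1 _ _ sim ker surj) => w Ww.
  by have [iP [iQ iS]] := int _ (or_introl erefl) _ Ww.
by have [iP [iQ iS]] := int _ (or_intror erefl) _ Ww.
Qed.

Lemma bi_subquot_ext (C : fieldType) (V : lmodType C) (X Y Z : V -> V) (W U U' : V -> Prop)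
    (M : bimod C) :
  (forall w, W w -> (U w <-> U' w)) ->
  bi_subquot_iso X Y Z W U M -> bi_subquot_iso X Y Z W U' M.
Proof.
move=> UU' [f [st [su [ke int]]]]; exists f; split=> //; split=> //; split=> // w Ww.
by rewrite -UU' // ke.
Qed.

Theorem theorem9p8 (R : realType) (k : 'I_3 -> R) (n t1 t2 t3 : nat) :
  odd n ->
  (* n >= t1 + t2 + t3 (with t_i = infinity allowed, this forces all t_i finite) *)
  tpar (k 0) = Some t1 -> tpar (k 1) = Some t2 -> tpar (k 2) = Some t3 ->
  (t1 + t2 + t3 <= n)%N ->
  let rc := fun x : R => (Complex x 0 : R[i]) in
  let K := rc (k 0 + k 1 + k 2) in
  let N : R[i] := (n.+1)%:R / 2 in
  let X := opX k in let Y := opY k in let Z := opZ k in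
  let Mall := fun v => Mnx k n 0 v /\ Mnx k n 1 v /\ Mnx k n 2 v in
  let W0 := Omod (n - (t1 + t2 + t3)) (rc (k 0) + N) (rc (k 1) + N) (rc (k 2) + N) in
  let A := Omod t1.-1 (- K - n%:R - 1) (rc (k 2)) (rc (k 1)) in
  let B := Omod t2.-1 (rc (k 2)) (- K - n%:R - 1) (rc (k 0)) in
  let Cm := Omod t3.-1 (rc (k 1)) (rc (k 0)) (- K - n%:R - 1) in
  (bi_subquot_iso X Y Z Mall (fun v => v = 0) (bisum W0 W0)) /\
      bi_subquot_iso X Y Z (Mn k n) (Mnx k n 0) (bisum A A) /\
      bi_subquot_iso X Y Z (Mn k n) (Mnx k n 1) (bisum B B) /\
      bi_subquot_iso X Y Z (Mn k n) (Mnx k n 2) (bisum Cm Cm) /\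
      bi_subquot_iso X Y Z (Mnx k n 0) Mall (bisum (bisum B B) (bisum Cm Cm)) /\
      bi_subquot_iso X Y Z (Mnx k n 1) Mall (bisum (bisum A A) (bisum Cm Cm)) /\
      bi_subquot_iso X Y Z (Mnx k n 2) Mall (bisum (bisum A A) (bisum B B)) /\
    (bi_irreducible W0 /\ bi_irreducible A /\ bi_irreducible B /\ bi_irreducible Cm).
Proof.
move=> n_odd tp1 tp2 tp3 len /=.
have [o1 k1] := tparP tp1; have [o2 k2] := tparP tp2; have [o3 k3] := tparP tp3.
have KE : Complex (k 0 + k 1 + k 2) 0 = - ((t1 + t2 + t3)%:R / 2) :> R[i].
  have -> : Complex (k 0 + k 1 + k 2) 0 = rc (k 0) + rc (k 1) + rc (k 2) :> R[i].
    by rewrite /rc; apply/eqP; rewrite eq_complex /= !addr0 !eqxx.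
  by rewrite k1 k2 k3 !natrD; field.
rewrite KE -/(rc (k 0)) -/(rc (k 1)) -/(rc (k 2)) k1 k2 k3.
have [d1 t1E] : exists d, t1 = d.+1 by case: (t1) o1 => // d _; exists d.
have [d2 t2E] : exists d, t2 = d.+1 by case: (t2) o2 => // d _; exists d.
have [d3 t3E] : exists d, t3 = d.+1 by case: (t3) o3 => // d _; exists d.
have [d nE] : exists d, n = (t1 + t2 + t3 + d)%N.
  by exists (n - (t1 + t2 + t3))%N; rewrite subnKC.
have e1 : ~~ odd d1 by move: o1; rewrite t1E.
have e2 : ~~ odd d2 by move: o2; rewrite t2E.
have e3 : ~~ odd d3 by move: o3; rewrite t3E.
have e : ~~ odd d by move: n_odd; rewrite nE !oddD o1 o2 o3; case: (odd d).
have c1 : cyc 0 1 2 by constructor 1.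
have c2 : cyc 1 2 0 by constructor 2.
have c3 : cyc 2 0 1 by constructor 3.
rewrite -{1}[(t1 + t2 + t3)%:R / 2]opprK !opprK nE addKn -nE.
pose X := opX k; pose Y := opY k; pose Z := opZ k.
have sM : bistable X Y Z (Mn k n).
  by move=> w Mw; split; [|split]; [exact: (Mn_biop c1)|exact: (Mn_biop c2)|exact: (Mn_biop c3)].
have MxM i t w : tpar (k i) = Some t -> Mnx k n i w -> Mn k n w.
  by move=> ti /(MnxE _ _ ti)[].
pose a : R[i] := (t1 + t2 + t3)%:R / 2 - n%:R - 1.
pose K1 : R[i] := - (t1%:R / 2); pose K2 : R[i] := - (t2%:R / 2); pose K3 : R[i] := - (t3%:R / 2).
have [pA iA] : piece X Y Z (Mn k n) (Mnx k n 0) (fun w => Mnx k n 1 w /\ Mnx k n 2 w)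
    (bisum (Omod t1.-1 a K3 K2) (Omod t1.-1 a K3 K2)) /\ bi_irreducible (Omod t1.-1 a K3 K2).
  have len1 : (d1.+1 + t2 + t3 <= n)%N by rewrite -t1E.
  have [h1 h2 h3 h4] := regular_A R[i] e1 len1.
  have [sim irr] := line_sim_O e1 h1 h2 h3 h4.
  have re := realization_first c1 tp1 tp2 tp3 n_odd len t1E.
  rewrite /a /K2 /K3 t1E /=; split; last exact: bi_irreducible_pair irr.
  exact: realization_piece re sim.
have [pB iB] : piece X Y Z (Mn k n) (Mnx k n 1) (fun w => Mnx k n 0 w /\ Mnx k n 2 w)
    (bisum (Omod t2.-1 K3 a K1) (Omod t2.-1 K3 a K1)) /\ bi_irreducible (Omod t2.-1 K3 a K1).
  have len2 : (t1 + d2.+1 + t3 <= n)%N by rewrite -t2E.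
  have [h1 h2 h3 h4] := regular_B R[i] e2 len2.
  have [sim irr] := line_sim_O e2 h1 h2 h3 h4.
  have re := realization_second c1 tp1 tp2 tp3 n_odd len t2E.
  rewrite /a /K1 /K3 t2E /=; split; last exact: bi_irreducible_pair irr.
  exact: realization_piece re sim.
have tC : (t2 + t3 + t1 = t1 + t2 + t3)%N by rewrite addnC addnA.
(* The exponent of [x_3] must vary along the line, so the axes are rotated to make [x_1] the fixed
   variable. Then [(P, Q, S)] is [(Y, Z, X)], and the rotated comparison restores the order
   [(X, Y, Z)]. *)
have [pC iC] : piece X Y Z (Mn k n) (Mnx k n 2) (fun w => Mnx k n 1 w /\ Mnx k n 0 w)
    (bisum (Omod t3.-1 K2 K1 a) (Omod t3.-1 K2 K1 a)) /\ bi_irreducible (Omod t3.-1 K2 K1 a).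
  have len3 : (t2 + d3.+1 + t1 <= n)%N by rewrite -t3E tC.
  have [h1 h2 h3 h4] := regular_B R[i] e3 len3.
  have h5 := beta_end_B R[i] t1 e3.
  have [sim irr] := line_sim_O_rot e3 h1 h2 h3 h4 (fun j => h5 j).
  have lenC : (t2 + t3 + t1 <= n)%N by rewrite tC.
  have re := realization_second c2 tp2 tp3 tp1 n_odd lenC t3E.
  rewrite /a /K1 /K2 -tC t3E /=.
  by split; [exact: realization_piece_rot re sim|exact: bi_irreducible_pair irr].
have sx i t W' M : tpar (k i) = Some t -> piece X Y Z (Mn k n) (Mnx k n i) W' M ->
    bistable X Y Z (Mnx k n i).
  move=> ti /(piece_stable sM) st w Mw.
  by have [[_ ?] [[_ ?] [_ ?]]] := st w (conj (MxM _ _ _ ti Mw) Mw).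
have s0 := sx _ _ _ _ tp1 pA; have s1 := sx _ _ _ _ tp2 pB; have s2 := sx _ _ _ _ tp3 pC.
have sI : bistable X Y Z (inner k 0 1 2 n).
  move=> w [w0 [w1 w2]]; have [? [? ?]] := s0 _ w0; have [? [? ?]] := s1 _ w1.
  by have [? [? ?]] := s2 _ w2.
have add i t v w : tpar (k i) = Some t -> Mnx k n i v -> Mnx k n i w -> Mnx k n i (v + w).
  by move=> ti Mv Mw; rewrite -[v]scale1r; apply: (Mnx_linear _ ti).
pose N : R[i] := n.+1%:R / 2.
have [pW iW] : piece X Y Z (inner k 0 1 2 n) (fun w => w = 0) (inner k 0 1 2 n)
    (bisum (Omod d (K1 + N) (K2 + N) (K3 + N)) (Omod d (K1 + N) (K2 + N) (K3 + N)))
    /\ bi_irreducible (Omod d (K1 + N) (K2 + N) (K3 + N)).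
  have NE : N = (t1 + t2 + t3 + d).+1%:R / 2 by rewrite /N {1}nE.
  have t1p : (0 < t1)%N by rewrite t1E.
  have t3p : (0 < t3)%N by rewrite t3E.
  have [h1 h2 h3 h4] := regular_W e NE t1p t3p.
  have [sim irr] := line_sim_O_swap e h1 h2 h3 h4.
  have re := realization_inner c1 tp1 tp2 tp3 n_odd len nE (fun w Ww => (sI w Ww).1)
    (fun w Ww => (sI w Ww).2.1).
  (* The line parameters are [- (K2 + N)] and [- (K1 + N)]; the swap negates and exchanges them,
     which gives the order in [W0]. *)
  rewrite !opprK in sim irr.
  by split; [exact: realization_piece re sim|exact: bi_irreducible_pair irr].
split; first exact: piece_subquot sI (fun _ => id) pW.
split; first by apply: piece_subquot pA => // w [/(MxM _ _ _ tp2)].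
split; first by apply: piece_subquot pB => // w [/(MxM _ _ _ tp1)].
split; first by apply: piece_subquot pC => // w [/(MxM _ _ _ tp2)].
split.
  (* Within [Mnx k n 0] the full intersection is the common kernel of the two quotient maps. Their
     preimages were found in [Mnx k n 0], each in the kernel of the other map. *)
  apply: (@bi_subquot_ext _ _ _ _ _ _ (fun w => Mnx k n 1 w /\ Mnx k n 2 w)) => [w w0|].
    by split=> [[]|[? []]].
  apply: piece_sum s0 _ _ pB pC => [v w|w|w [] //|w [] //]; first exact: (add _ _ _ _ tp1).
  exact: (MxM _ _ _ tp1).
split.
  apply: (@bi_subquot_ext _ _ _ _ _ _ (fun w => Mnx k n 0 w /\ Mnx k n 2 w)) => [w w1|].
    by split=> [[]|[? []]].
  apply: piece_sum s1 _ _ pA pC => [v w|w|w [] //|w [] //]; first exact: (add _ _ _ _ tp2).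
  exact: (MxM _ _ _ tp2).
split; last by [].
apply: (@bi_subquot_ext _ _ _ _ _ _ (fun w => Mnx k n 0 w /\ Mnx k n 1 w)) => [w w2|].
  by split=> [[]|[? []]].
apply: piece_sum s2 _ _ pA pB => [v w|w|w [] //|w [] //]; first exact: (add _ _ _ _ tp3).
exact: (MxM _ _ _ tp3).
Qed.
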